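(* Fix $j_0\in\mathcal{N}\setminus\{1\}$. Suppose that for each $j\in\mathcal{N}\setminus\{1,j_0\}$ the two-marginal problem $\inf\{\int c_{1j}\,d\tau:\tau\in\Pi(\mu_1,\mu_j)\}$ has its optimal plan induced by a unique transport map $T_j:X_1\to X_j$, i.e. the optimal plan is $(\mathrm{id}\times T_j)\#\mu_1$. Let $\lambda$ be an optimal plan of (MKP) and write $\pi_{1j_0}\#\lambda=\mu^{x_1}_{j_0}\otimes\mu_1$ with $\mu_{j_0}^{x_1}\in P(X_{j_0})$. Then $$\lambda=\Big(\prod_{j=2}^{j_0-1}\delta_{T_j(x_1)}\times\mu^{x_1}_{j_0}\times\prod_{j=j_0+1}^N\delta_{T_j(x_1)}\Big)\otimes\mu_1.$$ If in addition the two-marginal problem for $j=j_0$ has a unique solution, then (MKP) has a unique optimal plan.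
   Context: Let $N\ge 3$, $\mathcal{N}=\{1,\ldots,N\}$, $\mu_k$ Borel probability measures on complete separable metric spaces $X_k$; $\Pi(\cdot)$ denotes sets of probability measures with prescribed marginals. The cost $c:\prod_kX_k\to\mathbb{R}$ is lower semicontinuous with $c\ge\sum_ka_k(x_k)$, $a_k\in L_1(\mu_k)$; (MKP) is $\inf\{\int c\,d\lambda:\lambda\in\Pi(\mu_1,\ldots,\mu_N)\}$, assumed attained (minimizers = optimal plans). $(\varphi_1,\ldots,\varphi_N)$ is a fixed solution of the dual problem $\sup\{\sum_k\int\varphi_kd\mu_k:\varphi_k\in L_1(\mu_k),\sum_k\varphi_k(x_k)\le c\}$. For $j\in\mathcal{N}\setminus\{1\}$, $$c_{1j}(x_1,x_j)=\inf_{(x_k)_{k\in\mathcal{N}\setminus\{1,j\}}}\Big\{c(x_1,\ldots,x_N)-\sum_{k\in\mathcal{N}\setminus\{1,j\}}\varphi_k(x_k)\Big\},$$ and $\pi_{1j}:\prod_kX_k\to X_1\times X_j$ is the projection. For a measure $\sigma$ on $A$ and a measurable family $(\eta^a)$ of probability measures on $B$, $(\eta^a\otimes\sigma)(E\times F)=\int_E\eta^a(F)d\sigma(a)$; $\delta_y$ is a Dirac mass; the product of measures in the displayed formula is taken in the coordinate order $X_2,\ldots,X_N$. *)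

(* Defs.v *)
From HB Require Import structures.
From mathcomp Require Import all_boot all_order all_algebra.
From mathcomp Require Import all_classical all_reals all_analysis.

Set Implicit Arguments.
Unset Strict Implicit.
Unset Printing Implicit Defensive.

Import Order.TTheory GRing.Theory Num.Theory.

Local Open Scope classical_set_scope.
Local Open Scope ring_scope.

Notation Borel T := (g_sigma_algebraType (@open T)).

(* The index "1" of the paper, i.e. the first element of 'I_N (0-based). *)
Definition idx1 {N : nat} (hN : (3 <= N)%N) : 'I_N :=
  Ordinal (leq_trans (isT : (0 < 3)%N) hN).

(* Metric, complete and separable: a complete pseudometric space that is
   Hausdorff (hence a metric space) and has a countable dense subset. *)
Definition polish {R : realType} (T : completePseudoMetricType R) : Prop :=
  hausdorff_space T /\ exists D : set T, countable D /\ dense D.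

Section MK.
Context {R : realType} {N : nat} (X : 'I_N -> completePseudoMetricType R).

Definition PiX := prod_topology (fun k => X k).

Definition upd (x : PiX) (j : 'I_N) (y : X j) : PiX :=
  fun k => match j =P k with
           | ReflectT e => eq_rect j (fun i => X i) y k e
           | ReflectF _ => x k
           end.

Local Open Scope ereal_scope.

Definition is_plan (mu : forall k, probability (Borel (X k)) R)
    (lam : probability (Borel PiX) R) : Prop :=
  forall k (A : set (Borel (X k))), measurable A ->
    lam ((fun x : PiX => x k) @^-1` A) = mu k A.

Definition cost_of (c : PiX -> R) (lam : probability (Borel PiX) R) : \bar R :=
  \int[lam]_x (c x)%:E.

Definition optimal_plan (mu : forall k, probability (Borel (X k)) R)
    (c : PiX -> R) (lam : probability (Borel PiX) R) : Prop :=
  is_plan mu lam /\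
  forall lam' : probability (Borel PiX) R, is_plan mu lam' ->
    cost_of c lam <= cost_of c lam'.

Definition dual_admissible (mu : forall k, probability (Borel (X k)) R)
    (c : PiX -> R) (phi : forall k, X k -> R) : Prop :=
  (forall k, (mu k).-integrable [set: Borel (X k)] (fun x => (phi k x)%:E)) /\
  (forall x : PiX, (\sum_(k < N) phi k (x k) <= c x)%R).

Definition dual_value (mu : forall k, probability (Borel (X k)) R)
    (phi : forall k, X k -> R) : \bar R :=
  \sum_(k < N) \int[mu k]_x (phi k x)%:E.

Definition dual_solution (mu : forall k, probability (Borel (X k)) R)
    (c : PiX -> R) (phi : forall k, X k -> R) : Prop :=
  dual_admissible mu c phi /\
  forall psi, dual_admissible mu c psi -> dual_value mu psi <= dual_value mu phi.

Definition c1j (i1 : 'I_N) (c : PiX -> R) (phi : forall k, X k -> R)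
    (j : 'I_N) (x1 : X i1) (xj : X j) : \bar R :=
  ereal_inf [set ((c x - \sum_(k < N | (k != i1) && (k != j)) phi k (x k))%R)%:E
            | x in [set x : PiX | x i1 = x1 /\ x j = xj]].

Definition is_plan2 (i1 j : 'I_N) (mu1 : probability (Borel (X i1)) R)
    (muj : probability (Borel (X j)) R)
    (tau : probability (Borel (X i1 * X j)%type) R) : Prop :=
  (forall A : set (Borel (X i1)), measurable A -> tau (A `*` setT) = mu1 A) /\
  (forall B : set (Borel (X j)), measurable B -> tau (setT `*` B) = muj B).

Definition optimal_plan2 (i1 j : 'I_N) (mu1 : probability (Borel (X i1)) R)
    (muj : probability (Borel (X j)) R) (c12 : X i1 -> X j -> \bar R)
    (tau : probability (Borel (X i1 * X j)%type) R) : Prop :=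
  is_plan2 mu1 muj tau /\
  forall tau', is_plan2 mu1 muj tau' ->
    \int[tau]_z c12 z.1 z.2 <= \int[tau']_z c12 z.1 z.2.

End MK.
Arguments c1j {R N X} i1 c phi j x1 xj.
Arguments upd {R N X} x j y _.

(* Main.v *)
Require Import Defs.
From HB Require Import structures.
From mathcomp Require Import all_boot all_order all_algebra.
From mathcomp Require Import all_classical all_reals all_analysis.
From mathcomp Require Import measurable_realfun ring lra.

Set Implicit Arguments.
Unset Strict Implicit.
Unset Printing Implicit Defensive.

Import Order.TTheory GRing.Theory Num.Theory.
Import numFieldNormedType.Exports.

Local Open Scope classical_set_scope.
Local Open Scope ring_scope.

(** By admissibility the slack [c x - \sum_k phi_k (x_k)] is nonnegative. The
    heart of the proof is that there is no duality gap: some plan, and hence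
    every optimal plan, is concentrated on the contact set where the slack
    vanishes. To get such a plan, let [p f] be the infimum of
    [\sum_k \int psi_k] over all [psi] and [t >= 0] with
    [f <= \sum_k psi_k (x_k) + t * slack]; optimality of [phi] says exactly that
    [p] is finite on bounded functions. A linear functional below the sublinear
    [p] (Hahn-Banach) gives a finitely additive measure with the prescribed
    marginals, and it vanishes on every set where the slack is bounded below by
    a positive constant. Since Borel measures on Polish spaces are compact
    regular, it is sigma-additive on the algebra of sets that it approximates by
    compact sets from inside and from outside, so it extends to a plan. Lower
    semicontinuity of [c] makes [slack > 0] a countable union of Borel boxes of
    the above kind.

    For an optimal plan [lam], [c_1j = phi_1 + phi_j] almost everywhere for the
    projection of [lam] to [X_1 * X_j], so that projection solves the
    two-marginal problem. By hypothesis it sits on the graph of [T_j] when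
    [j != j_0]; therefore [lam] is determined by its projection to
    [X_1 * X_j0]. *)

(** * A Hahn-Banach lemma *)

Section HahnBanach.
Context {R : realType} {V : lmodType R} (S : set V).
Hypotheses (S0 : S 0) (SD : forall x y, S x -> S y -> S (x + y))
  (SZ : forall (a : R) x, S x -> S (a *: x)).

(** The linear space is a set [S] inside an ambient module, so that bounded functions can be treated
    inside all functions. Homogeneity for [t > 0] already forces [q 0 = 0]. *)
Definition sublinear_on (q : V -> R) :=
  (forall x y, S x -> S y -> q (x + y) <= q x + q y) /\
  (forall (t : R) x, 0 < t -> S x -> q (t *: x) = t * q x).

Let SN x : S x -> S (- x).
Proof. by move=> Sx; rewrite -scaleN1r; exact: SZ. Qed.

Lemma sublinear_on0 q : sublinear_on q -> q 0 = 0.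
Proof.
case=> _ qZ; have := qZ 2 0 ltac:(lra) S0; rewrite scaler0; lra.
Qed.

Lemma sublinear_on_geN q x : sublinear_on q -> S x -> - q (- x) <= q x.
Proof.
move=> hq Sx; have := hq.1 x (- x) Sx (SN Sx).
rewrite subrr (sublinear_on0 hq); lra.
Qed.

(** The pointwise infimum works: [- p (- x) <= q x] for each member bounds it from below, and of two
    members of the chain the smaller one serves for both summands in subadditivity. *)
Lemma sublinear_on_chain_lb (p : V -> R) (A : set (V -> R)) :
  A !=set0 -> (forall q, A q -> sublinear_on q) ->
  (forall q x, A q -> S x -> q x <= p x) ->
  (forall q1 q2, A q1 -> A q2 ->
    (forall x, S x -> q1 x <= q2 x) \/ (forall x, S x -> q2 x <= q1 x)) ->
  exists q, sublinear_on q /\ forall q', A q' -> forall x, S x -> q x <= q' x.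
Proof.
move=> [q0 Aq0] Asub Ap Atot.
pose E x := [set q x | q in A]; pose q x := inf (E x).
have hE x : S x -> has_inf (E x).
  move=> Sx; split; first by exists (q0 x), q0.
  exists (- p (- x)) => _ [q1 Aq1 <-].
  have := sublinear_on_geN (Asub _ Aq1) Sx.
  by have := Ap _ _ Aq1 (SN Sx); lra.
have qle q1 x : A q1 -> S x -> q x <= q1 x.
  by move=> Aq1 Sx; apply: (ge_inf (hE x Sx).2); exists q1.
have leq (z : R) x : S x -> (forall q1, A q1 -> z <= q1 x) -> z <= q x.
  move=> Sx h; apply: lb_le_inf; first exact: (hE x Sx).1.
  by move=> _ [q1 Aq1 <-]; exact: h.
have qZle (t : R) x : 0 < t -> S x -> q (t *: x) <= t * q x.
  move=> t0 Sx; rewrite -ler_pdivrMl//; apply: (leq) => // q1 Aq1.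
  by rewrite ler_pdivrMl// -(Asub _ Aq1).2//; apply: qle => //; exact: SZ.
exists q; split; last by move=> q1 Aq1 x Sx; exact: qle.
split=> [x y Sx Sy|t x t0 Sx].
  rewrite -lerBlDr; apply: (leq) => // q1 Aq1.
  rewrite lerBlDr [leRHS]addrC -lerBlDr; apply: (leq) => // q2 Aq2.
  rewrite lerBlDr [leRHS]addrC.
  have [h|h] := Atot _ _ Aq1 Aq2.
    apply: le_trans (qle _ _ Aq1 (SD Sx Sy)) _.
    by apply: le_trans ((Asub _ Aq1).1 _ _ Sx Sy) _; rewrite lerD2l; exact: h.
  apply: le_trans (qle _ _ Aq2 (SD Sx Sy)) _.
  by apply: le_trans ((Asub _ Aq2).1 _ _ Sx Sy) _; rewrite lerD2r; exact: h.
apply/eqP; rewrite eq_le qZle//= -ler_pdivlMl//.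
by rewrite -[x in q x <= _](scalerK (lt0r_neq0 t0)) qZle ?invr_gt0//; exact: SZ.
Qed.

(** For fixed [y], the infimum over [s >= 0] of [q (z + s *: y) - s * q y] is sublinear in [z] and
    below [q]. Minimality puts [q] below it, and [s = 1] gives [q x + q y <= q (x + y)]. *)
Lemma minimal_sublinear_on_additive q : sublinear_on q ->
  (forall r, sublinear_on r -> (forall x, S x -> r x <= q x) ->
     forall x, S x -> q x <= r x) ->
  forall x y, S x -> S y -> q (x + y) = q x + q y.
Proof.
move=> hq qmin x y Sx Sy; apply/eqP; rewrite eq_le hq.1//=.
pose E z := [set q (z + s *: y) - s * q y | s in [set s : R | 0 <= s]].
pose r z := inf (E z).
have q00 := sublinear_on0 hq.
have hE z : S z -> has_inf (E z).
  move=> Sz; split; first by exists (q (z + 0 *: y) - 0 * q y), 0 => /=.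
  exists (- q (- z)) => _ [s /= s0 <-].
  have : q (s *: y) <= q (z + s *: y) + q (- z).
    have := hq.1 (z + s *: y) (- z) (SD Sz (SZ s Sy)) (SN Sz).
    by rewrite addrAC subrr add0r.
  have /orP[/eqP<-|s_gt0] : (0 == s) || (0 < s) by rewrite -le_eqVlt.
    by rewrite scale0r q00 !mul0r; lra.
  by rewrite [q (s *: y)]hq.2//; lra.
have rle s z : 0 <= s -> S z -> r z <= q (z + s *: y) - s * q y.
  by move=> s0 Sz; apply: (ge_inf (hE z Sz).2); exists s.
have ler (a : R) z : S z ->
    (forall s, 0 <= s -> a <= q (z + s *: y) - s * q y) -> a <= r z.
  move=> Sz h; apply: lb_le_inf; first exact: (hE z Sz).1.
  by move=> _ [s s0 <-]; exact: h.
have rZle (t : R) z : 0 < t -> S z -> r (t *: z) <= t * r z.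
  move=> t0 Sz; rewrite -ler_pdivrMl//; apply: (ler) => // s s0.
  rewrite ler_pdivrMl//.
  apply: le_trans (rle (t * s) _ _ (SZ t Sz)) _; first by rewrite mulr_ge0// ltW.
  rewrite -scalerA -scalerDr hq.2//; last exact: SD (SZ s Sy).
  by rewrite mulrBr mulrA.
have rq z : S z -> r z <= q z.
  by move=> Sz; have := rle 0 z (lexx 0) Sz; rewrite scale0r addr0 mul0r subr0.
suff : q x <= r x.
  have := rle 1 x ler01 Sx; rewrite scale1r mul1r; lra.
apply: qmin => //; split=> [u v Su Sv|t u t0 Su].
  rewrite -lerBlDr; apply: (ler) => // s s0.
  rewrite lerBlDr [leRHS]addrC -lerBlDr; apply: (ler) => // s' s'0.
  rewrite lerBlDr [leRHS]addrC.
  apply: le_trans (rle (s + s') _ (addr_ge0 s0 s'0) (SD Su Sv)) _.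
  have := hq.1 (u + s *: y) (v + s' *: y) (SD Su (SZ s Sy)) (SD Sv (SZ s' Sy)).
  rewrite addrACA -scalerDl mulrDl; lra.
apply/eqP; rewrite eq_le rZle//= -ler_pdivlMl//.
by rewrite -[u in r u <= _](scalerK (lt0r_neq0 t0)) rZle ?invr_gt0//; exact: SZ.
Qed.

(* Hahn-Banach: a minimal sublinear functional below [p] is linear. *)
Lemma sublinear_on_linear_minorant (p : V -> R) : sublinear_on p ->
  exists L : V -> R, [/\ forall x y, S x -> S y -> L (x + y) = L x + L y,
    forall (t : R) x, 0 < t -> S x -> L (t *: x) = t * L x &
    forall x, S x -> L x <= p x].
Proof.
move=> hp.
pose W := {q : V -> R | sublinear_on q /\ forall x, S x -> q x <= p x}.
pose wp : W := exist _ p (conj hp (fun x _ => lexx (p x))).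
(* The order is reversed, so a maximal element in Zorn's lemma is a minimal functional. *)
pose le_W (q q' : W) : bool := `[< forall x, S x -> sval q' x <= sval q x >].
have [||A Atot|q qmax] := @ZL_preorder W wp le_W.
- by move=> q; apply/asboolP => x _; exact: lexx.
- move=> q1 q2 q3 /asboolP h12 /asboolP h23; apply/asboolP => x Sx.
  exact: le_trans (h23 _ Sx) (h12 _ Sx).
- have [->|/set0P[q0 Aq0]] := eqVneq A set0; first by exists wp => s [].
  have [||||q [hq qA]] := @sublinear_on_chain_lb p [set sval q | q in A].
  + by exists (sval q0), q0.
  + by move=> _ [q _ <-]; exact: (svalP q).1.
  + by move=> _ x [q _ <-]; exact: (svalP q).2.
  + move=> _ _ [q1 Aq1 <-] [q2 Aq2 <-].
    by have [/asboolP h|/asboolP h] := Atot _ _ Aq1 Aq2; [right|left].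
  have qp x : S x -> q x <= p x.
    move=> Sx; apply: le_trans ((svalP q0).2 x Sx).
    by apply: qA => //; exists q0.
  exists (exist _ q (conj hq qp)) => s As; apply/asboolP => x Sx.
  by apply: qA => //; exists s.
exists (sval q); split; [|exact: (svalP q).1.2|exact: (svalP q).2].
apply: minimal_sublinear_on_additive; first exact: (svalP q).1.
move=> r hr rq x Sx.
have rp y : S y -> r y <= p y.
  by move=> Sy; apply: le_trans (rq _ Sy) ((svalP q).2 y Sy).
pose wr : W := exist _ r (conj hr rp).
have /asboolP : le_W wr q by apply: qmax; apply/asboolP.
exact.
Qed.
End HahnBanach.

(** * Compact regularity *)

(** Caratheodory extension. [m] is a bare function because the algebra of sets it is used on is
    itself built inside a later proof. *)
Lemma content_extension d (T : semiRingOfSetsType d) (R : realType)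
    (m : set T -> \bar R) :
  (forall A, 0 <= m A)%E -> measure_function.semi_additive m ->
  measurable_subset_sigma_subadditive m ->
  exists mu : {measure set (g_sigma_algebraType (@measurable _ T)) -> \bar R},
    forall A : set T, d.-measurable A -> mu A = m A.
Proof.
move=> m0 mD ms.
pose c1 := isContent.Build _ T R m m0 mD.
pose ct : {content set T -> \bar R} := HB.pack m c1.
pose c2 := Content_SigmaSubAdditive_isMeasure.Build _ R T ct ms.
pose mu0 : {measure set T -> \bar R} := HB.pack (Content.sort ct) c2.
have [mu <-] : exists mu : {measure set T -> \bar R}, mu = m :> (set T -> \bar R).
  by exists mu0.
exists (measure_extension mu) => A mA.
exact: measurable_mu_extE.
Qed.

Lemma pushforward_probability d d' (T : measurableType d) (U : measurableType d')
    (R : realType) (mu : {measure set T -> \bar R}) (f : T -> U) :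
  measurable_fun setT f -> mu setT = 1%E ->
  exists P : probability U R, forall A, P A = mu (f @^-1` A).
Proof.
move=> mf mu1; pose p (A : set U) := mu (f @^-1` A).
have p0 : p set0 = 0%E by rewrite /p preimage_set0 measure0.
have p_ge0 A : (0 <= p A)%E by exact: measure_ge0.
have pS : semi_sigma_additive p.
  exact: (@measure_semi_sigma_additive _ _ _
    (measure_function_pushforward__canonical__measure_function_Measure mu mf)).
have p1 : p setT = 1%E by rewrite /p preimage_setT.
pose mm := isMeasure.Build _ U R p p0 p_ge0 pS.
pose pm : {measure set U -> \bar R} := HB.pack p mm.
pose pp := Measure_isProbability.Build _ U R pm p1.
pose P : probability U R := HB.pack (Measure.sort pm) pp.
by exists P.
Qed.

(** The remainders decrease to the empty set, and a finite measure is continuous from above. *)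
Lemma measure_bigcup_approx d (T : measurableType d) (R : realType)
    (P : probability T R) (F : nat -> set T) (e : R) :
  (forall n, measurable (F n)) -> 0 < e -> exists n,
    (P (\bigcup_i F i `\` \big[setU/set0]_(i < n) F i) <= e%:E)%E.
Proof.
move=> mF e0; pose G n := \bigcup_i F i `\` \big[setU/set0]_(i < n) F i.
have mG n : measurable (G n).
  by apply: measurableD; [exact: bigcupT_measurable|exact: bigsetU_measurable].
have G0 : \bigcap_n G n = set0.
  rewrite -subset0 => x Gx; have [[i _ Fix] _] := Gx 0%N I.
  have [_ []] := Gx i.+1 I; rewrite -(bigcup_mkord i.+1 F).
  by exists i => //=.
have : (P \o G) n @[n --> \oo] --> P (\bigcap_n G n).
  apply: nonincreasing_cvg_mu => //.
  - by rewrite (le_lt_trans (probability_le1 _ _)) ?ltry.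
  - by rewrite G0.
  - move=> m n mn; apply/subsetPset; apply: setDS.
    exact: subset_bigsetU.
rewrite G0 measure0 => /fine_cvgP[fG /cvgrPdist_le /(_ _ e0)].
move=> [N _ /(_ _ (leqnn N))]; rewrite sub0r normrN => h; exists N.
rewrite -[leLHS]fineK; last by rewrite fin_num_measure//; exact: mG.
by rewrite lee_fin; apply: le_trans h; exact: ler_norm.
Qed.

Section CompactRegular.
Local Open Scope ereal_scope.
Context {R : realType} {T : ptopologicalType}.
Hypothesis hT : hausdorff_space T.
Implicit Types (A : set T) (e : R).

Lemma closed_Borel A : closed A -> measurable (A : set (Borel T)).
Proof.
move=> cA; rewrite -[A]setCK; apply: measurableC.
by apply: sub_sigma_algebra; exact: closed_openC.
Qed.

Lemma compact_Borel A : compact A -> measurable (A : set (Borel T)).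
Proof. by move=> cA; apply: closed_Borel; exact: compact_closed. Qed.

(** Approximating [A] and its complement at once makes the notion stable under complements. For
    [A = set0] it is tightness of [m]. *)
Definition compact_regular (m : set (Borel T) -> \bar R) A := forall e, (0 < e)%R ->
  exists K K' : set T, [/\ compact K, compact K', K `<=` A, K' `<=` ~` A &
    m (~` (K `|` K')) <= e%:E].

Lemma compact_regularC m A : compact_regular m A -> compact_regular m (~` A).
Proof.
move=> rA e e0; have [K [K' [cK cK' KA KA' mK]]] := rA e e0.
by exists K', K; rewrite setCK setUC.
Qed.

Section content.
Variable m : {content set (Borel T) -> \bar R}.

(** What is missed by the union of the inner sets together with the intersection of the outer ones
    is missed by one of the two given pairs. *)
Lemma compact_regularU A B :
  compact_regular m A -> compact_regular m B -> compact_regular m (A `|` B).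
Proof.
move=> rA rB e e0; have e20 : (0 < e / 2)%R by rewrite divr_gt0.
have [K1 [K1' [cK1 cK1' KA1 KA1' mK1]]] := rA _ e20.
have [K2 [K2' [cK2 cK2' KA2 KA2' mK2]]] := rB _ e20.
exists (K1 `|` K2), (K1' `&` K2'); split.
- exact: compactU.
- by apply: compact_closedI => //; exact: compact_closed.
- exact: setUSS.
- by rewrite setCU; exact: setISS.
have mK A1 : compact A1 -> measurable (A1 : set (Borel T)) by exact: compact_Borel.
rewrite [e in _ <= e%:E]splitr EFinD.
apply: le_trans (leeD mK1 mK2); apply: le_trans (measureU2 _ _ _).
- apply: le_measure; rewrite ?inE; last first.
    rewrite -setCI; apply: subsetC => x [[K1x|K1'x] [K2x|K2'x]];
      by [left; left|left; right|right; split].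
  + by apply: measurableU; apply: measurableC; apply: measurableU; exact: mK.
  + apply: measurableC; apply: measurableU; first by apply: measurableU; exact: mK.
    by apply: measurableI; exact: mK.
- by apply: measurableC; apply: measurableU; exact: mK.
- by apply: measurableC; apply: measurableU; exact: mK.
Qed.

Lemma compact_regularI A B :
  compact_regular m A -> compact_regular m B -> compact_regular m (A `&` B).
Proof.
move=> rA rB; rewrite -[A `&` B]setCK setCI; apply: compact_regularC.
by apply: compact_regularU; exact: compact_regularC.
Qed.

Lemma compact_regular0 A : compact_regular m A -> compact_regular m set0.
Proof.
move=> rA; rewrite -(setICr A).
by apply: compact_regularI => //; exact: compact_regularC.
Qed.

(* The compact inner approximation of [A] is covered by finitely many of the
   open outer approximations of the [F n]. *)
Lemma compact_regular_sigma_subadditive A (F : nat -> set T) :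
  measurable (A : set (Borel T)) ->
  (forall n, measurable (F n : set (Borel T))) ->
  compact_regular m A -> (forall n, compact_regular m (F n)) ->
  A `<=` \bigcup_n F n -> m A <= \sum_(n <oo) m (F n).
Proof.
move=> mA mF rA rF AF; apply/lee_addgt0Pr => _/posnumP[e].
have mK B : compact B -> measurable (B : set (Borel T)) by exact: compact_Borel.
have [K [K' [cK cK' KA KA' mKK]]] := rA (e%:num / 2)%R [gt0 of e%:num / 2]%R.
(* These tolerances add up to [e / 2]; the other half pays for replacing [A] by [K]. *)
have en n : (0 < e%:num / 2 / (2 ^ n.+1)%:R)%R.
  by rewrite divr_gt0// ltr0n expn_gt0.
have /choice[k hk] : forall n, exists k : set T * set T,
    [/\ compact k.1, compact k.2, k.1 `<=` F n, k.2 `<=` ~` F n &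
    m (~` (k.1 `|` k.2)) <= (e%:num / 2 / (2 ^ n.+1)%:R)%:E].
  by move=> n; have [L [L' h]] := rF n _ (en n); exists (L, L').
have oC n : open (~` (k n).2).
  by have [_ c2 _ _ _] := hk n; apply: closed_openC; exact: compact_closed.
have mO n : m (~` (k n).2) <= m (F n) + (e%:num / 2 / (2 ^ n.+1)%:R)%:E.
  have [c1 c2 kF kF' mk] := hk n.
  apply: le_trans (leeD (le_refl _) mk); apply: le_trans (measureU2 _ _ _) => //.
  + apply: le_measure; rewrite ?inE.
    * by apply: measurableC; exact: mK.
    * by apply: measurableU => //; apply: measurableC; apply: measurableU; exact: mK.
    * move=> x k2x; have [Fx|nFx] := pselect (F n x); [by left|right].
      by move=> [/kF|].
  + by apply: measurableC; apply: measurableU; exact: mK.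
have := cK; rewrite compact_cover => /(_ _ setT (fun n => ~` (k n).2)) [].
- by move=> n _; exact: oC.
- move=> x /KA/AF[n _ Fnx]; exists n => // k2x.
  by have [_ _ _ /(_ _ k2x)] := hk n.
(* All indices of the finite subcover lie below [N]. *)
move=> D _ KD; pose N := (\max_(i <- finmap.enum_fset D) i).+1.
have mKN : m K <= \sum_(i < N) m (~` (k i).2).
  apply: (@content_subadditive _ _ _ m K (fun n => ~` (k n).2)) => //.
  - move=> i _; apply: measurableC; apply: mK.
    by have [] := hk i.
  - exact: mK.
  - move=> x /KD[i /= iD kix]; rewrite -(bigcup_mkord N (fun n => ~` (k n).2)); exists i => //=.
    by rewrite /N ltnS; apply: leq_bigmax_seq.
have AK : m A <= m K + (e%:num / 2)%:E.
  apply: le_trans (leeD (le_refl _) mKK); apply: le_trans (measureU2 _ _ _) => //.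
  + apply: le_measure; rewrite ?inE//.
    * apply: measurableU; first exact: mK.
      by apply: measurableC; apply: measurableU; exact: mK.
    * move=> x Ax; have [Kx|nKx] := pselect (K x); [by left|right].
      by move=> [//|/KA'].
  + exact: mK.
  + by apply: measurableC; apply: measurableU; exact: mK.
apply: le_trans AK _; rewrite [e%:num in leRHS]splitr EFinD addeA leeD2r//.
apply: le_trans (epsilon_trick _ _ _) => //.
apply: (le_trans mKN); apply: le_trans; first by apply: lee_sum => i _; exact: mO.
rewrite -(big_mkord xpredT (fun i => m (F i) + (e%:num / 2 / (2 ^ i.+1)%:R)%:E)).
apply: nneseries_lim_ge => i _ _.
by rewrite adde_ge0// lee_fin ltW.
Qed.

Definition regular_Borel : set (set T) :=
  [set A | measurable (A : set (Borel T)) /\ compact_regular m A].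

(** The regular Borel sets form an algebra on which [m] is sigma-subadditive, so the extension
    theorem applies; by [gen] the generated sigma-algebra contains all Borel sets. *)
Lemma regular_content_extension : m setT = 1 -> compact_regular m set0 ->
  (forall A : set (Borel T), measurable A -> <<s regular_Borel >> A) ->
  exists P : probability (Borel T) R, forall A, regular_Borel A -> P A = m A.
Proof.
move=> m1 r0 gen.
have G0 : regular_Borel set0 by split; [exact: measurable0|].
have GU : setU_closed regular_Borel.
  by move=> A B [mA rA] [mB rB]; split; [exact: measurableU|exact: compact_regularU].
have GC : setC_closed regular_Borel.
  by move=> A [mA rA]; split; [exact: measurableC|exact: compact_regularC].
pose mx := isAlgebraOfSets.Build default_measure_display T G0 GU GC.
pose TT : algebraOfSetsType default_measure_display := HB.pack T mx.
pose m' : set TT -> \bar R := m.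
have m'0 A : 0 <= m' A by exact: measure_ge0.
have m'D : measure_function.semi_additive m'.
  move=> F n mF tF _; apply: measure_semi_additive => //.
    by move=> k; exact: (mF k).1.
  by apply: bigsetU_measurable => k _; exact: (mF k).1.
have m's : @measurable_subset_sigma_subadditive _ R TT m'.
  move=> A F mF mA; apply: compact_regular_sigma_subadditive.
  - exact: mA.1.
  - by move=> n; exact: (mF n).1.
  - exact: mA.2.
  - by move=> n; exact: (mF n).2.
have [mu muE] := @content_extension _ TT R m' m'0 m'D m's.
have mu1 : mu setT = 1.
  rewrite -m1; apply: muE; split; first exact: measurableT.
  by rewrite -setC0; exact: compact_regularC.
(* Pushing forward along the identity restricts the extension to the Borel sigma-algebra. *)
have idm : measurable_fun setT
    (id : g_sigma_algebraType (@measurable _ TT) -> Borel T).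
  by move=> _ A mA; rewrite setTI preimage_id; exact: gen.
have [P PE] := pushforward_probability idm mu1.
by exists P => A GA; rewrite PE muE.
Qed.
End content.
Section measure.
Variable P : probability (Borel T) R.

(** Inside, finitely many inner compact sets suffice up to [e / 2]; outside, the intersection of all
    outer ones is taken. Continuity from above enters, hence a measure and not just a content. *)
Lemma compact_regular_bigcup (F : nat -> set T) :
  (forall n, compact_regular P (F n)) -> compact_regular P (\bigcup_n F n).
Proof.
move=> rF _/posnumP[e].
have mK B : compact B -> measurable (B : set (Borel T)) by exact: compact_Borel.
have en n : (0 < e%:num / 2 / (2 ^ n.+1)%:R)%R.
  by rewrite divr_gt0// ltr0n expn_gt0.
have /choice[k hk] : forall n, exists k : set T * set T,
    [/\ compact k.1, compact k.2, k.1 `<=` F n, k.2 `<=` ~` F n &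
    P (~` (k.1 `|` k.2)) <= (e%:num / 2 / (2 ^ n.+1)%:R)%:E].
  by move=> n; have [L [L' h]] := rF n _ (en n); exists (L, L').
have mk1 n : measurable ((k n).1 : set (Borel T)) by apply: mK; have [] := hk n.
have mk2 n : measurable ((k n).2 : set (Borel T)) by apply: mK; have [] := hk n.
have [N PN] := measure_bigcup_approx P mk1 [gt0 of e%:num / 2]%R.
exists (\big[setU/set0]_(i < N) (k i).1), (\bigcap_n (k n).2); split.
- by apply: bigsetU_compact => i _; have [] := hk i.
- apply: (@subclosed_compact _ _ (k 0%N).2).
  + apply: closed_bigI => n _; have [_ c2 _ _ _] := hk n.
    exact: compact_closed.
  + by have [] := hk 0%N.
  + by move=> x /(_ 0%N); exact.
- rewrite -(bigcup_mkord N (fun n => (k n).1)) => x [n _ kx]; exists n => //.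
  by have [_ _ /(_ _ kx)] := hk n.
- move=> x kx [n _ Fx]; have [_ _ _ + _] := hk n.
  by apply; [exact: kx|exact: Fx].
set KN := \big[setU/set0]_(i < N) (k i).1.
have mKN : measurable (KN : set (Borel T)) by apply: bigsetU_measurable.
have mc : measurable (\bigcap_n (k n).2 : set (Borel T)).
  exact: bigcapT_measurable.
have mn n : measurable (~` ((k n).1 `|` (k n).2) : set (Borel T)).
  by apply: measurableC; exact: measurableU.
rewrite [e%:num]splitr EFinD.
apply: (@le_trans _ _ (P (\bigcup_n (k n).1 `\` KN `|`
    \bigcup_n ~` ((k n).1 `|` (k n).2)))).
  apply: le_measure; rewrite ?inE.
  - by apply: measurableC; exact: measurableU.
  - apply: measurableU; last exact: bigcupT_measurable.
    by apply: measurableD => //; exact: bigcupT_measurable.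
  - move=> x nx; have [k1x|nk1x] := pselect ((\bigcup_n (k n).1) x).
      by left; split => // KNx; apply: nx; left.
    right; apply: contrapT => nk; apply: nx; right => n _.
    apply: contrapT => nk2; apply: nk; exists n => // -[k1|//].
    by apply: nk1x; exists n.
apply: le_trans (measureU2 _ _ _) _.
- by apply: measurableD => //; exact: bigcupT_measurable.
- exact: bigcupT_measurable.
apply: leeD => //.
apply: le_trans (epsilon_trick0 xpredT _); last by [].
apply: le_trans (_ : _ <= \sum_(n <oo) P (~` ((k n).1 `|` (k n).2))) _.
  by apply: measure_sigma_subadditive => //; exact: bigcupT_measurable.
by apply: lee_nneseries => // n _; have [] := hk n.
Qed.

Lemma compact_regular_sigma_algebra (G : set (set T)) :
  compact_regular P set0 -> G `<=` compact_regular P ->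
  <<s G >> `<=` compact_regular P.
Proof.
move=> r0 Gr; apply: smallest_sub => //; split => //.
- by move=> A rA; rewrite setTD; exact: compact_regularC.
- by move=> F rF; exact: compact_regular_bigcup.
Qed.

End measure.
End CompactRegular.

(** * Polish spaces: countable base, tightness, regularity *)

Section Polish.
Context {R : realType} (T : completePseudoMetricType R).
Hypothesis hT : polish T.

Let invS_gt0 n : 0 < (n.+1%:R^-1 : R).
Proof. by rewrite invr_gt0. Qed.

Let invS_lt (e : R) : 0 < e -> exists n, (n.+1%:R^-1 : R) < e.
Proof.
move=> e0; have [n _ /(_ _ (leqnn n))] := near_infty_natSinv_lt (PosNum e0).
by exists n.
Qed.

(** The injection [f] numbers a countable dense set, which may be finite. Interiors are taken since
    [ball] is not assumed open. *)
Lemma polish_cover : exists (D : set T) (f : T -> nat),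
  {in D &, injective f} /\ forall x (r : R), 0 < r ->
    exists2 d, D d & (ball d r)° x.
Proof.
have [_ [D [/countable_injP[f finj] dD]]] := hT.
exists D, f; split=> // x r r0.
have r20 : 0 < r / 2 by rewrite divr_gt0.
have [|d [bd Dd]] := dD (ball x (r / 2))° _ (@open_interior _ _).
  by exists x; exact: nbhsx_ballx.
exists d => //; have xd := ball_sym (interior_subset bd).
apply/nbhs_ballP; exists (r / 2) => //= z; rewrite [r in ball d r]splitr.
exact: ball_triangle.
Qed.

Lemma polish_countable_base : exists U : nat -> set T,
  (forall n, open (U n)) /\
  forall x O, nbhs x O -> exists2 n, U n x & U n `<=` O.
Proof.
have [D [f [finj Dball]]] := polish_cover.
(* [n] codes the number [i] of a center and a radius [1 / (j + 1)]; as [f] is injective, the union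
   contains at most one ball. A code without meaning gives the empty set. *)
pose U n := if unpickle n is Some (i, j) then
  (\bigcup_(d in [set d | D d /\ f d = i]) ball d (j.+1%:R^-1 : R))° else set0.
exists U; split=> [n|x O /nbhs_ballP[e /= e0 xeO]].
  by rewrite /U; case: unpickle => [[i j]|]; [exact: open_interior|exact: open0].
have [j je] := invS_lt (divr_gt0 e0 (ltr0n R 2)).
have [d Dd xd] := Dball x (j.+1%:R^-1) (invS_gt0 _).
exists (pickle (f d, j)); rewrite /U pickleK.
  by apply: filterS xd => z dz; exists d.
move=> z /interior_subset[d' [Dd' fd'] d'z].
have dd : d' = d by apply: finj => //; rewrite inE.
rewrite dd in d'z; apply: xeO; rewrite [e]splitr.
apply: (@ball_triangle _ _ d).
  by apply: ball_sym; apply: le_ball (interior_subset xd); exact: ltW.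
by apply: le_ball d'z; exact: ltW.
Qed.

(** Ulam's theorem: for each [n], finitely many balls of radius [1 / (n + 1)] miss mass at most
    [e / 2 ^ (n + 1)]. The intersection over [n] of the unions of their closures is closed and
    totally bounded, hence compact by completeness. *)
Lemma polish_tight (P : probability (Borel T) R) :
  compact_regular P set0.
Proof.
have [D [f [finj Dball]]] := polish_cover.
move=> _/posnumP[e].
pose V n i : set T :=
  (\bigcup_(d in [set d | D d /\ f d = i]) ball d (n.+1%:R^-1 : R))°.
have mV n i : measurable (V n i : set (Borel T)).
  by apply: sub_sigma_algebra; exact: open_interior.
have VT n : \bigcup_i V n i = setT.
  rewrite -subTset => x _; have [d Dd xd] := Dball x (n.+1%:R^-1) (invS_gt0 _).
  by exists (f d) => //; apply: filterS xd => z dz; exists d.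
have en n : (0 < e%:num / (2 ^ n.+1)%:R)%R by rewrite divr_gt0// ltr0n expn_gt0.
have /choice[N hN] n := measure_bigcup_approx P (mV n) (en n).
pose C n := \big[setU/set0]_(i < N n) closure (V n i).
have cC n : closed (C n).
  by rewrite /C; apply: closed_bigsetU => i _; exact: closed_closure.
pose K := \bigcap_n C n.
have cK : closed K by apply: closed_bigI => n _; exact: cC.
exists set0, K; split.
- exact: compact0.
- rewrite compact_ultra => F UF FK.
  suff /cauchy_cvg cF : cauchy F.
    exists (lim F); split=> //.
    exact: (@closed_cvg _ _ F _ id K cK FK _ cF).
  apply: cauchy_exP => r /= r0.
  have [n nr] := invS_lt (divr_gt0 r0 (ltr0n R 2)).
  have : F (C n) by apply: filterS FK => x; exact.
  rewrite /C => FC.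
  (* An ultrafilter that contains a finite union contains one member. That member lies within [r] of
     one center, so the ultrafilter is Cauchy. *)
  have [i FVi] : exists i, F (closure (V n i)).
    elim: (N n) FC => [|m ih].
      by rewrite big_ord0 => /filter_not_empty.
    rewrite big_ord_recr/= => FU.
    have [|FC] := in_ultra_setVsetC (closure (V n m)) UF; first by exists m.
    by apply: ih; apply: filterS (filterI FU FC) => x [[]].
  have [z Vz] := filter_ex FVi.
  have [w [/interior_subset[d [Dd fd] dw] _]] := Vz _ filterT.
  exists d; apply: filterS FVi => y Vy.
  have [v [/interior_subset[d' [Dd' fd'] d'v] yv]] :=
    Vy _ (nbhsx_ballx y _ (invS_gt0 n)).
  have dd : d' = d by apply: finj; rewrite ?inE// fd' fd.
  rewrite dd in d'v; rewrite [r]splitr; apply: (@ball_triangle _ _ v).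
    by apply: le_ball d'v; exact: ltW.
  by apply: ball_sym; apply: le_ball yv; exact: ltW.
- exact: sub0set.
- by rewrite setC0.
rewrite set0U /K setC_bigcap.
have mC n : measurable (~` C n : set (Borel T)).
  by apply: sub_sigma_algebra; exact: closed_openC.
apply: le_trans (epsilon_trick0 xpredT _); last by [].
apply: (@le_trans _ _ (\sum_(n <oo) P (~` C n))%E).
  by apply: measure_sigma_subadditive => //; exact: bigcupT_measurable.
apply: lee_nneseries => // n _; apply: le_trans (hN n).
apply: le_measure; rewrite ?inE//.
  apply: measurableD; first exact: bigcupT_measurable.
  exact: bigsetU_measurable.
rewrite VT setTD; apply: subsetC.
rewrite /C -(bigcup_mkord (N n) (V n)).
rewrite -(bigcup_mkord (N n) (fun i => closure (V n i))).
by apply: subset_bigcup => i _; exact: subset_closure.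
Qed.

(** Open sets suffice, as regular sets form a sigma-algebra. An open set is a countable union of
    closed sets, and closed sets become compact when cut with a compact set of almost full mass. *)
Lemma polish_compact_regular (P : probability (Borel T) R) (A : set (Borel T)) :
  measurable A -> compact_regular P A.
Proof.
have [U [oU Ubase]] := polish_countable_base.
have hK B := @compact_closed T B hT.1.
have tight := polish_tight P.
suff hO : open `<=` compact_regular P.
  exact: (compact_regular_sigma_algebra hT.1 tight hO).
move=> {A} O oO _/posnumP[e]; have e20 : 0 < e%:num / 2 by rewrite divr_gt0.
(* Closures of basic sets that stay inside [O]; regularity of the space makes them exhaust [O]. *)
pose W n : set T := if `[< closure (U n) `<=` O >] then closure (U n) else set0.
have cW n : closed (W n).
  by rewrite /W; case: ifP => _; [exact: closed_closure|exact: closed0].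
have WO : \bigcup_n W n = O.
  rewrite eqEsubset; split=> [x [n _]|x Ox].
    by rewrite /W; case: asboolP => // UO /UO.
  have [B nB BO] : filter_from (nbhs x) closure O.
    by apply: uniform_regular; exact: open_nbhs_nbhs.
  have [n Unx UB] := Ubase _ _ nB; exists n => //.
  rewrite /W asboolT; first exact: subset_closure.
  exact: subset_trans (closure_subset UB) BO.
have mW n : measurable (W n : set (Borel T)) by exact: closed_Borel.
have [N PN] := measure_bigcup_approx P mW e20.
have [_ [K [_ cK -> _ PK]]] : exists K0 K, [/\ compact K0, compact K, K0 = set0,
    True & (P (~` (K0 `|` K)) <= (e%:num / 2)%:E)%E].
  have [K0 [K [cK0 cK K00 _ PK]]] := tight _ e20.
  by exists K0, K; split => //; rewrite -subset0.
rewrite set0U in PK; set WN := \big[setU/set0]_(i < N) W i in PN.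
have cWN : closed WN by apply: closed_bigsetU.
exists (WN `&` K), (~` O `&` K); split.
- by rewrite setIC; apply: compact_closedI.
- by rewrite setIC; apply: compact_closedI => //; exact: open_closedC.
- apply: subset_trans (@subIsetl _ _ _) _; rewrite -WO.
  by rewrite /WN -(bigcup_mkord N W) => x [i _ ?]; exists i.
- exact: subIsetl.
have mWN : measurable (WN : set (Borel T)) by exact: closed_Borel.
have mKB : measurable (K : set (Borel T)) by apply: closed_Borel; exact: hK.
have mO : measurable (O : set (Borel T)) by exact: sub_sigma_algebra.
rewrite WO in PN; rewrite [e%:num]splitr EFinD; apply: le_trans (leeD PN PK).
apply: le_trans (measureU2 _ _ _); last 2 first.
- exact: measurableD.
- exact: measurableC.
apply: le_measure; rewrite ?inE.
- apply: measurableC; apply: measurableU; apply: measurableI => //.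
  exact: measurableC.
- by apply: measurableU; [exact: measurableD|exact: measurableC].
- move=> x nx; have [Kx|] := pselect (K x); last by right.
  left; split.
    by apply: contrapT => nO; apply: nx; right.
  by move=> Wx; apply: nx; left.
Qed.

End Polish.

(** * The product space *)

Lemma continuous_Borel_measurable (T U : ptopologicalType) (f : T -> U) :
  continuous f -> measurable_fun setT (f : Borel T -> Borel U).
Proof.
move=> cf; apply: (@measurability _ _ (Borel T) (Borel U) _ _ open) => //.
move=> _ [V oV <-]; rewrite setTI; apply: sub_sigma_algebra.
by apply: open_comp => // x _; exact: cf.
Qed.

Lemma content_subadditive_big d (T : ringOfSetsType d) (R : realFieldType)
    (m : {content set T -> \bar R}) (I : Type) (s : seq I) (F : I -> set T) :
  (forall i, measurable (F i)) ->
  (m (\big[setU/set0]_(i <- s) F i) <= \sum_(i <- s) m (F i))%E.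
Proof.
move=> mF; elim: s => [|i s ih]; first by rewrite !big_nil measure0.
rewrite !big_cons; apply: le_trans (leeD (le_refl _) ih).
by apply: measureU2 => //; exact: bigsetU_measurable.
Qed.

(* [PiX X] has separate topological and pointed structures; this joins them. *)
Definition PiX_ptop {R : realType} {N : nat} (X : 'I_N -> completePseudoMetricType R)
  : ptopologicalType :=
  HB.pack (prod_topology (fun k => X k)) (Pointed.class (PiX X : pointedType)).

Section Product.
Context {R : realType} {N : nat} (X : 'I_N -> completePseudoMetricType R).
Hypothesis hX : forall k, polish (X k).

Lemma PiX_hausdorff : hausdorff_space (PiX X).
Proof. exact: (@hausdorff_product _ (fun k => X k) (fun k => (hX k).1)). Qed.

Lemma PiX_proj_continuous k : continuous (fun x : PiX X => x k).
Proof. exact: (@proj_continuous _ (fun i => X i) k). Qed.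

Lemma PiX_proj_measurable k :
  measurable_fun setT ((fun x => x k) : Borel (PiX X) -> Borel (X k)).
Proof.
exact: (@continuous_Borel_measurable (PiX_ptop X) (X k) (fun x => x k) (@PiX_proj_continuous k)).
Qed.

(** The sets containing a box around [x] form a filter. The product topology is a supremum of
    initial topologies, so its convergence to [x] is checked one coordinate at a time. *)
Lemma PiX_nbhs_box (x : PiX X) (O : set (PiX X)) : nbhs x O ->
  exists A : forall k, set (X k), (forall k, nbhs (x k) (A k)) /\
    forall y : PiX X, (forall k, A k (y k)) -> O y.
Proof.
pose F : set_system (PiX X) := [set P | exists A : forall k, set (X k),
  (forall k, nbhs (x k) (A k)) /\ forall y : PiX X, (forall k, A k (y k)) -> P y].
have FF : Filter F.
  split.
  - by exists (fun=> setT); split=> // k; exact: filterT.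
  - move=> P Q [A [nA AP]] [B [nB BQ]]; exists (fun k => A k `&` B k).
    split=> [k|y ABy]; first exact: filterI.
    by split; [apply: AP|apply: BQ] => k; have [] := ABy k.
  - by move=> P Q PQ [A [nA AP]]; exists A; split=> // y /AP; exact: PQ.
suff : F --> x by apply.
apply/cvg_sup => i; apply/cvg_image.
  rewrite eqEsubset; split => // y _; exists (dfwith (x : forall k, X k) i y) => //.
  by rewrite dfwithin.
move=> B nB; exists [set y | B (y i)].
  (* The box is [B] in coordinate [i] and the whole space elsewhere, where the quantification over
     [i = k] is vacuous. *)
  exists (fun k => [set z | forall e : i = k, B (eq_rect_r (fun k => X k : Type) z e)]); split.
    move=> k; have [ik|ik] := eqVneq i k.
      case: k / ik; apply: filterS nB => z Bz e.
      by rewrite (eq_irrelevance e erefl).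
    by apply: nearW => z e; case/eqP: ik.
  by move=> y /(_ i erefl).
rewrite eqEsubset; split=> [_ [y /= By <-]//|z Bz].
exists (dfwith (x : forall k, X k) i z) => /=; by rewrite dfwithin.
Qed.

Lemma PiX_countable_boxes : exists U : forall k, nat -> set (X k),
  (forall k n, open (U k n)) /\
  forall O, open O -> forall x : PiX X, O x -> exists g : {ffun 'I_N -> nat},
    (forall k, U k (g k) (x k)) /\
    forall y : PiX X, (forall k, U k (g k) (y k)) -> O y.
Proof.
pose U k := sval (cid (polish_countable_base (hX k))).
have hU k := svalP (cid (polish_countable_base (hX k))).
exists U; split=> [k|O oO x Ox]; first exact: (hU k).1.
have [A [nA AO]] := PiX_nbhs_box (open_nbhs_nbhs (conj oO Ox)).
have /choice[g hg] : forall k, exists n, U k n (x k) /\ U k n `<=` A k.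
  by move=> k; have [n] := (hU k).2 _ _ (nA k); exists n.
exists (finfun g); split=> [k|y Uy]; first by rewrite ffunE; exact: (hg k).1.
by apply: AO => k; apply: (hg k).2; have := Uy k; rewrite ffunE.
Qed.

Lemma measurable_big_preimage d (Z : measurableType d) (f : forall k, Z -> X k)
    (A : forall k, set (X k)) :
  (forall k, measurable_fun setT (f k : Z -> Borel (X k))) ->
  (forall k, measurable (A k : set (Borel (X k)))) ->
  measurable [set z | forall k, A k (f k z)].
Proof.
move=> mf mA.
have -> : [set z | forall k, A k (f k z)] = \bigcap_(k in [set: 'I_N]) (f k @^-1` A k).
  by rewrite eqEsubset; split=> z Az k => [_|]; exact: Az.
apply: fin_bigcap_measurable => [|k _]; first exact: finite_finset.
by rewrite -[X in measurable X]setTI; apply: mf.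
Qed.

(** By second countability an open set is a countable union of basic boxes, so the coordinates
    generate the Borel sets of the product. *)
Lemma PiX_measurable_fun d (Z : measurableType d) (f : Z -> PiX X) :
  (forall k, measurable_fun setT ((fun z => f z k) : Z -> Borel (X k))) ->
  measurable_fun setT (f : Z -> Borel (PiX X)).
Proof.
move=> mf; have [U [oU hU]] := PiX_countable_boxes.
apply: (@measurability _ _ Z (Borel (PiX X)) setT f (@open (PiX X))) => //.
move=> _ [V oV <-]; rewrite setTI.
pose B (g : {ffun 'I_N -> nat}) : set Z := [set z | (forall k, U k (g k) (f z k)) /\
  forall y : PiX X, (forall k, U k (g k) (y k)) -> V y].
have -> : f @^-1` V = \bigcup_g B g.
  rewrite eqEsubset; split=> [z /= Vz|z [g _ [Ug]]]; last exact.
  by have [g hg] := hU V oV (f z) Vz; exists g.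
apply: countable_bigcupT_measurable => // g.
have [h|h] := pselect (forall y : PiX X, (forall k, U k (g k) (y k)) -> V y).
  rewrite (_ : B g = [set z | forall k, U k (g k) (f z k)]).
    apply: (@measurable_big_preimage _ Z (fun k z => f z k) (fun k => U k (g k))) => // k.
    by apply: sub_sigma_algebra; exact: oU.
  by rewrite eqEsubset; split=> z => [[]|].
by rewrite (_ : B g = set0)// -subset0 => z [].
Qed.

(** The marginals are tight, and by Tychonoff a box of compact sets is compact. Its complement is
    covered by [N] cylinders, whose masses under [m] are read off the marginals. *)
Lemma PiX_cylinder_compact_regular (mu : forall k, probability (Borel (X k)) R)
    (m : {content set (Borel (PiX X)) -> \bar R}) :
  (forall k (A : set (Borel (X k))), measurable A ->
    m ((fun x : PiX X => x k) @^-1` A) = mu k A) ->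
  forall k (A : set (Borel (X k))), measurable A ->
    @compact_regular _ (PiX_ptop X) m ((fun x : PiX X => x k) @^-1` A).
Proof.
(* Each of the [N] coordinates may lose mass [r]; dividing by [N.+1] keeps the divisor positive. *)
move=> mE k A mA _/posnumP[e]; pose r := e%:num / N.+1%:R.
have r0 : 0 < r by rewrite divr_gt0.
have [K [K' [cK cK' KA KA' PK]]] := polish_compact_regular (hX k) (mu k) mA r0.
(* Coordinate [k] uses the union of [K] and [K'], the others a compact set from tightness. The
   transported equation expresses the first case for a variable index. *)
have exC j : exists C : set (X j), compact C /\ (mu j (~` C) <= r%:E)%E /\
    (forall e : k = j, C = eq_rect k (fun i => set (X i)) (K `|` K') j e).
  have [kj|kj] := eqVneq k j.
    case: j / kj; exists (K `|` K'); split; first exact: compactU.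
    by split=> // e'; rewrite (eq_irrelevance e' erefl).
  have [C0 [C [_ cC C00 _ PC]]] := polish_tight (hX j) (mu j) r0.
  exists C; split=> //; split; last by move=> e'; case/eqP: kj.
  by move: PC; rewrite (_ : C0 = set0) ?set0U// -subset0.
pose C j := sval (cid (exC j)).
have hC j := svalP (cid (exC j)).
have Ck : C k = K `|` K' := (hC k).2.2 erefl.
pose B : set (PiX X) := [set x | forall j, C j (x j)].
have cB : compact B by apply: (@tychonoff _ (fun i => X i)) => j; exact: (hC j).1.
have clK (L : set (X k)) : compact L -> closed ((fun x : PiX X => x k) @^-1` L).
  move=> cL; apply: closed_comp => [x _|]; first exact: PiX_proj_continuous.
  exact: (compact_closed (hX k).1).
exists (B `&` (fun x : PiX X => x k) @^-1` K), (B `&` (fun x : PiX X => x k) @^-1` K').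
split.
- by apply: compact_closedI => //; exact: clK.
- by apply: compact_closedI => //; exact: clK.
- by move=> x [_ /KA].
- by move=> x [_ /KA'].
rewrite -setIUr -preimage_setU -Ck.
have -> : ~` (B `&` (fun x : PiX X => x k) @^-1` C k) =
    \big[setU/set0]_(j <- index_enum 'I_N) ((fun x : PiX X => x j) @^-1` (~` C j)).
  rewrite -bigcup_seq eqEsubset; split=> x.
    move=> nB; apply: contrapT => h.
    have h' : B x.
      move=> j; apply: contrapT => nC; apply: h; exists j => //=.
      by rewrite mem_index_enum.
    by apply: nB; split=> //; exact: h'.
  by move=> [j _ nCj] [Bx _]; apply: nCj; exact: Bx.
have mC j : measurable (~` C j : set (Borel (X j))).
  by apply: measurableC; apply: (compact_Borel (hX j).1); exact: (hC j).1.
apply: le_trans (content_subadditive_big _ _ _) _.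
  move=> j; rewrite -[X in measurable X]setTI.
  exact: PiX_proj_measurable (mC j).
apply: (@le_trans _ _ (\sum_(j < N) r%:E)%E).
  by apply: lee_sum => j _; rewrite mE//; exact: (hC j).2.1.
rewrite sumEFin lee_fin sumr_const card_ord -mulr_natr.
apply: (@le_trans _ _ (r * N.+1%:R)); last by rewrite /r divfK.
by rewrite ler_pM2l// ler_nat.
Qed.

End Product.

(** * Absence of a duality gap *)

Section Duality.
Context {R : realType} {N : nat} (X : 'I_N -> completePseudoMetricType R).
Hypotheses (N_gt0 : (0 < N)%N) (hX : forall k, polish (X k)).
Variable mu : forall k, probability (Borel (X k)) R.
Variables (c : PiX X -> R) (phi : forall k, X k -> R).
Arguments phi : clear implicits.
Hypothesis hphi : dual_solution mu c phi.
Implicit Types (psi : forall k, X k -> R) (x y : PiX X) (f g : PiX X -> R).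

Let ae_integrable psi :=
  forall k, (mu k).-integrable [set: Borel (X k)] (fun z => (psi k z)%:E).

Let total psi : R := \sum_(k < N) Rintegral (mu k) setT (psi k).

Let slack x : R := c x - \sum_(k < N) phi k (x k).

Let slack_ge0 x : 0 <= slack x.
Proof. by rewrite subr_ge0; exact: hphi.1.2. Qed.

Let dual_valueE psi : ae_integrable psi -> dual_value mu psi = (total psi)%:E.
Proof.
move=> ipsi; rewrite /dual_value /total -sumEFin; apply: eq_bigr => k _.
by rewrite /Rintegral fineK//; apply: integrable_fin_num.
Qed.

Let integrable_lin psi psi' (r : R) : ae_integrable psi -> ae_integrable psi' ->
  ae_integrable (fun k z => psi k z + r * psi' k z).
Proof.
move=> h h' k.
by apply: eq_integrable (integrableD measurableT (h k)
  (integrableZl measurableT r (h' k))).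
Qed.

Let total_lin psi psi' (r : R) : ae_integrable psi -> ae_integrable psi' ->
  total (fun k z => psi k z + r * psi' k z) = total psi + r * total psi'.
Proof.
move=> h h'; rewrite /total mulr_sumr -big_split/=; apply: eq_bigr => k _.
rewrite RintegralD//=; [|exact: h|exact: (integrableZl measurableT r (h' k))].
by rewrite RintegralZl//; exact: h'.
Qed.

Let integrable_cst (r : R) : ae_integrable (fun k z => r).
Proof. by move=> k; apply: finite_measure_integrable_cst. Qed.

(** Constants are spread evenly over the [N] coordinates, which turns them into sums of functions of
    one coordinate. *)
Let total_cst (r : R) : total (fun k z => r / N%:R) = r.
Proof.
rewrite /total (eq_bigr (fun=> r / N%:R)) => [|k _]; last first.
  rewrite Rintegral_cst//; rewrite (_ : fine _ = 1) ?mulr1//.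
  by rewrite -[1]/(fine 1%E); congr fine; exact: probability_setT.
by rewrite sumr_const card_ord -(mulr_natr (r / N%:R)) divfK// pnatr_eq0 -lt0n.
Qed.

Let sum_cst (r : R) : \sum_(k < N) (r / N%:R) = r.
Proof. by rewrite sumr_const card_ord -(mulr_natr (r / N%:R)) divfK// pnatr_eq0 -lt0n. Qed.

(* If [total psi < 0], then [phi - psi / t] is admissible with a larger dual
   value than [phi]. *)
Let total_ge0 psi (t : R) : ae_integrable psi -> 0 <= t ->
  (forall x, 0 <= \sum_(k < N) psi k (x k) + t * slack x) -> 0 <= total psi.
Proof.
(* Since the slack is nonnegative, [t = 0] may be replaced by [t = 1]. *)
move=> ipsi t0 h; wlog tp : t t0 h / 0 < t.
  move=> hw; have [|tp] := ltP 0 t; first exact: hw h.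
  apply: (hw 1) => // x; have := h x; rewrite (_ : t = 0); last by lra.
  by rewrite mul0r addr0 mul1r => ?; exact: addr_ge0.
have [iphi _] := hphi.1.
have i' := integrable_lin (- t^-1) iphi ipsi.
have /(hphi.2) : dual_admissible mu c (fun k z => phi k z + - t^-1 * psi k z).
  split=> // x; rewrite big_split/= -mulr_sumr mulNr -subr_ge0.
  have : 0 <= t^-1 * (\sum_(k < N) psi k (x k) + t * slack x).
    by rewrite mulr_ge0// ?invr_ge0.
  rewrite mulrDr mulKf ?gt_eqF// /slack; lra.
rewrite !dual_valueE// total_lin// lee_fin mulNr.
by rewrite gerDl oppr_le0 pmulr_rge0// invr_gt0.
Qed.

Let bounded : set (PiX X -> R) := [set f | exists M, forall x, `|f x| <= M].

(** Multiples of the slack are free of charge. This forces a functional below [price] to vanish on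
    sets where the slack is bounded below by a positive constant. *)
Let majorant f psi (t : R) := [/\ ae_integrable psi, 0 <= t &
  forall x, f x <= \sum_(k < N) psi k (x k) + t * slack x].

Let price_set f := [set total psi | psi in [set psi | exists t, majorant f psi t]].
Let price f := inf (price_set f).

(** Optimality of [phi] enters here: if [|f| <= M], adding [M / N] to each component makes a
    majorant nonnegative, so its total is at least [- M]. *)
Let price_has_inf f : bounded f -> has_inf (price_set f).
Proof.
move=> [M fM]; split.
  exists (total (fun k z => M / N%:R)), (fun k z => M / N%:R) => //.
  exists 0; split=> // x.
  by rewrite mul0r addr0 sum_cst; apply: le_trans (fM x); exact: ler_norm.
exists (- M) => _ [psi [t [ipsi t0 h]] <-].
have : 0 <= total (fun k z => psi k z + 1 * (M / N%:R)).
  apply: (@total_ge0 _ t) => [|//|x].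
    by apply: integrable_lin => //; exact: integrable_cst.
  rewrite big_split/= mul1r sum_cst.
  have := fM x; rewrite ler_norml => /andP[fM' _].
  have := h x; lra.
by rewrite total_lin ?total_cst//; lra.
Qed.

Let price_le f psi (t : R) : bounded f -> majorant f psi t -> price f <= total psi.
Proof.
by move=> bf h; apply: (ge_inf (price_has_inf bf).2); exists psi => //; exists t.
Qed.

Let price_ge f (r : R) : bounded f ->
  (forall psi t, majorant f psi t -> r <= total psi) -> r <= price f.
Proof.
move=> bf h; apply: lb_le_inf; first exact: (price_has_inf bf).1.
by move=> _ [psi [t hp] <-]; exact: h hp.
Qed.

Let bounded0 : bounded 0.
Proof. by exists 0 => x; rewrite normr0. Qed.

Let boundedD f g : bounded f -> bounded g -> bounded (f + g).
Proof.
move=> [M fM] [M' gM']; exists (M + M') => x.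
exact: le_trans (ler_normD _ _) (lerD (fM x) (gM' x)).
Qed.

Let boundedZ (r : R) f : bounded f -> bounded (r *: f).
Proof.
move=> [M fM]; exists (`|r| * M) => x.
by rewrite [_ x]/(r * f x) normrM ler_wpM2l.
Qed.

Let price_sublinear : sublinear_on bounded price.
Proof.
have zle (t : R) f : 0 < t -> bounded f -> price (t *: f) <= t * price f.
  move=> t0 bf; rewrite -ler_pdivrMl//; apply: price_ge => // psi s [ipsi s0 h].
  rewrite ler_pdivrMl// -[leRHS]add0r.
  have -> : 0 = total (fun k z => 0 / N%:R) by rewrite total_cst.
  rewrite -total_lin//.
  apply: (@price_le _ _ (t * s)); first exact: boundedZ.
  split; [|by rewrite mulr_ge0// ltW|move=> x].
    by apply: integrable_lin => //; exact: integrable_cst.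
  rewrite big_split/= sum_cst add0r -mulr_sumr -mulrA -mulrDr.
  by rewrite [_ x]/(t * f x) ler_wpM2l// ltW.
split=> [f g bf bg|t f t0 bf].
  rewrite -lerBlDr; apply: price_ge => // psi s [ipsi s0 h].
  rewrite lerBlDr [leRHS]addrC -lerBlDr; apply: price_ge => // psi' s' [ipsi' s'0 h'].
  rewrite lerBlDr [leRHS]addrC.
  rewrite -[total psi']mul1r -total_lin//.
  apply: (@price_le _ _ (s + s')); first exact: boundedD.
  split; [exact: integrable_lin|exact: addr_ge0|move=> x].
  rewrite big_split/= -mulr_sumr mul1r mulrDl.
  have -> : (f + g) x = f x + g x :> R by [].
  by have := h x; have := h' x; lra.
apply/eqP; rewrite eq_le zle//= -ler_pdivlMl//.
by rewrite -[f in price f <= _](scalerK (lt0r_neq0 t0)) zle ?invr_gt0//; exact: boundedZ.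
Qed.

Let bounded_indic (A : set (PiX X)) : bounded (\1_A : PiX X -> R).
Proof.
by exists 1 => x; rewrite indicE; case: (x \in A); rewrite ?normr1 ?normr0.
Qed.

(* The Hahn-Banach functional below [price], restricted to indicators. *)
Lemma dual_content : exists m : {content set (Borel (PiX X)) -> \bar R},
  (forall k (A : set (Borel (X k))), measurable A ->
    m ((fun x => x k) @^-1` A) = mu k A) /\
  (forall (A : set (PiX X)) (r : R), 0 < r ->
    (forall x, A x -> r <= c x - \sum_(k < N) phi k (x k)) -> m A = 0%E).
Proof.
have [L [LD LZ Lp]] :=
  sublinear_on_linear_minorant bounded0 boundedD boundedZ price_sublinear.
have L0 : L 0 = 0 by apply: (addrI (L 0)); rewrite -LD// !addr0.
have LN f : bounded f -> L (- f) = - L f.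
  move=> bf; have bN : bounded (- f) by rewrite -scaleN1r; exact: boundedZ.
  by apply: (addrI (L f)); rewrite -LD// !subrr L0.
(* Zero majorizes [- \1_A], whence [L (- \1_A) <= 0]. *)
have Lge0 (A : set (PiX X)) : 0 <= L \1_A.
  rewrite -oppr_le0 -LN//; have bN : bounded (- \1_A : PiX X -> R).
    by rewrite -scaleN1r; exact: boundedZ.
  apply: le_trans (Lp _ bN) _; rewrite -[leRHS](total_cst 0).
  apply: (@price_le _ _ (0)) => //; split=> // x.
  by rewrite sum_cst mul0r addr0 [_ x]/(- \1_A x) oppr_le0 indicE ler0n.
have LU (A B : set (PiX X)) : A `&` B = set0 -> L \1_(A `|` B) = L \1_A + L \1_B.
  move=> AB; rewrite -LD//; congr L; apply/funext => x.
  have -> : (\1_A + \1_B) x = \1_A x + \1_B x :> R by [].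
  rewrite !indicE in_setU.
  have [xA|xA] := boolP (x \in A); have [xB|xB] := boolP (x \in B);
    rewrite /= ?mulr0n ?addr0 ?add0r//.
  by move: xA xB; rewrite !inE => Ax Bx; have : (A `&` B) x by []; rewrite AB.
pose m (A : set (Borel (PiX X))) : \bar R := (L \1_A)%:E.
have m0 A : (0 <= m A)%E by rewrite lee_fin.
have mD : measure_function.semi_additive m.
  apply/additive2P.
    by rewrite /m (_ : \1_set0 = 0) ?L0// indic0.
  by move=> A1 A2 _ _ A12; rewrite /m LU// EFinD.
pose cm := isContent.Build _ (Borel (PiX X)) R m m0 mD.
pose M : {content set (Borel (PiX X)) -> \bar R} := HB.pack m cm.
have cyl k (A : set (Borel (X k))) : measurable A ->
    L \1_((fun x : PiX X => x k) @^-1` A) <= fine (mu k A).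
  move=> mA; apply: le_trans (Lp _ (bounded_indic _)) _.
  (* The majorant is the indicator of [A] in coordinate [k] and zero in the others; its total is the
     mass of [A]. *)
  pose psi j : X j -> R := if pselect (k = j) is left e then
     \1_(eq_rect k (fun i => set (X i)) A j e) else cst 0.
  have psik : psi k = \1_A.
    by rewrite /psi; case: pselect => // e; rewrite (eq_irrelevance e erefl).
  have psij j : j != k -> psi j = cst 0.
    by move=> jk; rewrite /psi; case: pselect => // e; case/eqP: jk.
  have ipsi : ae_integrable psi.
    move=> j; have [->|jk] := eqVneq j k; first by rewrite psik; exact: integrable_indic.
    by rewrite psij//; exact: integrable_cst.
  have -> : fine (mu k A) = total psi.
    rewrite /total (bigD1 k)//= psik big1 => [|j jk]; last first.
      by rewrite psij// Rintegral_cst// mul0r.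
    by rewrite addr0 /Rintegral integral_indic// setIT.
  apply: (@price_le _ _ (0)) => //; split=> // x.
  rewrite mul0r addr0 (bigD1 k)//= psik big1 => [|j jk]; last by rewrite psij.
  by rewrite addr0; exact: lexx.
(* The constant [- 1] has a majorant of total [- 1]. *)
have LT : 1 <= L \1_[set: PiX X].
  have bN : bounded (- \1_[set: PiX X] : PiX X -> R).
    by rewrite -scaleN1r; exact: boundedZ.
  rewrite -[leRHS]opprK lerNr -LN//; apply: le_trans (Lp _ bN) _.
  rewrite -[leRHS](total_cst (- 1)); apply: (@price_le _ _ 0) => //.
  split=> // x; rewrite sum_cst mul0r addr0.
  have -> : (- \1_[set: PiX X]) x = - \1_[set: PiX X] x :> R by [].
  by rewrite indicT.
exists M; split=> [k B mB|B r r0 h].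
  have fB : mu k B \is a fin_num by rewrite fin_num_measure.
  rewrite -(fineK fB).
  congr EFin; apply/eqP; rewrite eq_le cyl//=.
  (* The upper bounds for [B] and its complement add up to 1, while the total mass is at least 1; so
     both are equalities. *)
  have := LU _ _ (setICr ((fun x : PiX X => x k) @^-1` B)).
  rewrite setUv => LB.
  have := cyl k _ (measurableC mB); rewrite preimage_setC probability_setC//.
  by rewrite fineB//=; lra.
(* [r *: \1_B] is at most the slack, so zero functions with [t = 1] majorize it and its price is at
   most 0. *)
congr EFin; apply/eqP; rewrite eq_le Lge0 andbT -(pmulr_rle0 _ r0) -LZ//.
have bB : bounded (r *: \1_B) by exact: boundedZ.
apply: le_trans (Lp _ bB) _; rewrite -[leRHS](total_cst 0).
apply: (@price_le _ _ 1) => //; split=> // x.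
rewrite sum_cst add0r mul1r.
have -> : (r *: \1_B) x = r * \1_B x :> R by [].
rewrite indicE; have [/set_mem Bx|_] := boolP (x \in B).
  by rewrite mulr1; exact: h.
by rewrite mulr0.
Qed.
End Duality.

(** * From the content to a plan on the contact set *)

Section Plan.
Context {R : realType} {N : nat} (X : 'I_N -> completePseudoMetricType R).
Hypotheses (N_gt0 : (0 < N)%N) (hX : forall k, polish (X k)).
Variable mu : forall k, probability (Borel (X k)) R.

(** Cylinders are compact regular and generate the Borel sets, so [m] extends. Boxes are finite
    intersections of cylinders, and agreement on them later carries null boxes over from [m] to
    [P]. *)
Lemma plan_of_content (m : {content set (Borel (PiX X)) -> \bar R}) :
  (forall k (A : set (Borel (X k))), measurable A ->
    m ((fun x : PiX X => x k) @^-1` A) = mu k A) ->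
  exists P : probability (Borel (PiX X)) R, is_plan mu P /\
    forall A : forall k, set (X k),
    (forall k, measurable (A k : set (Borel (X k)))) ->
    P [set x | forall k, A k (x k)] = m [set x | forall k, A k (x k)].
Proof.
move=> mE; pose k0 := Ordinal N_gt0.
have cyl k (A : set (Borel (X k))) : measurable A ->
    @regular_Borel _ (PiX_ptop X) m ((fun x : PiX X => x k) @^-1` A).
  move=> mA; split; last exact: PiX_cylinder_compact_regular mE _ _ mA.
  by rewrite -[X in measurable X]setTI; exact: PiX_proj_measurable.
have hP := @PiX_hausdorff _ _ _ hX.
have r0 : @compact_regular _ (PiX_ptop X) m set0.
  exact: (@compact_regular0 R (PiX_ptop X) hP m _ (cyl k0 _ measurableT).2).
have m1 : m setT = 1%E.
  rewrite -(probability_setT (mu k0)) -(mE k0 _ measurableT).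
  by rewrite preimage_setT.
have gen (A : set (Borel (PiX X))) : measurable A ->
    <<s @regular_Borel _ (PiX_ptop X) m >> A.
  move=> mA; pose Z := g_sigma_algebraType (@regular_Borel _ (PiX_ptop X) m).
  have /(_ measurableT _ mA) : measurable_fun setT (id : Z -> Borel (PiX X)).
    apply: PiX_measurable_fun => // k _ B mB.
    by rewrite setTI; apply: sub_sigma_algebra; exact: cyl.
  by rewrite setTI preimage_id.
have [P PE] := @regular_content_extension R (PiX_ptop X) hP m m1 r0 gen.
exists P; split=> [k A mA|A mA].
  by rewrite -mE// -PE//; exact: cyl.
apply: PE.
have -> : [set x : PiX X | forall k, A k (x k)] =
    \big[setI/setT]_(k < N) ((fun x : PiX X => x k) @^-1` A k).
  rewrite -bigcap_seq eqEsubset; split=> x h k; first by move=> _; exact: h.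
  by apply: h; rewrite /= mem_index_enum.
apply: (@big_ind _ (@regular_Borel _ (PiX_ptop X) m)) => [|B C [mB rB] [mC rC]|k _].
- split; first exact: measurableT.
  by rewrite -setC0; exact: compact_regularC.
- by split; [exact: measurableI|exact: compact_regularI].
- exact: cyl.
Qed.

Variables (c : PiX X -> R) (phi : forall k, X k -> R).
Arguments phi : clear implicits.
Hypothesis c_lsc : lower_semicontinuous (fun x : PiX X => (c x)%:E).
Hypothesis hphi : dual_solution mu c phi.

Let mphi k : measurable_fun setT (phi k : Borel (X k) -> R).
Proof. by apply/measurable_EFinP; exact: (measurable_int (mu k) (hphi.1.1 k)). Qed.

(* The set where [sum phi < c] is a countable union of products of Borel sets
   on each of which [c - sum phi] is bounded below by a positive constant. *)
Lemma slack_gt0_cover : exists F : nat -> forall k, set (X k),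
  (forall n k, measurable (F n k : set (Borel (X k)))) /\
  [set x | \sum_(k < N) phi k (x k) < c x] `<=`
  \bigcup_(n in [set n | exists2 r : R, 0 < r & forall x : PiX X,
     (forall k, F n k (x k)) -> r <= c x - \sum_(k < N) phi k (x k)])
  [set x | forall k, F n k (x k)].
Proof.
have [U [oU Ubox]] := PiX_countable_boxes hX.
(* [n] codes a basic box [g] and rational upper bounds [q] for the functions [phi k]. *)
pose F n k : set (X k) :=
  if @unpickle ({ffun 'I_N -> nat} * {ffun 'I_N -> rat})%type n is Some (g, q)
  then U k (g k) `&` [set z | phi k z < ratr (q k)] else set0.
exists F; split=> [n k|x /= xlt].
  rewrite /F; case: unpickle => [[g q]|]; last exact: measurable0.
  apply: measurableI; first by apply: sub_sigma_algebra; exact: oU.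
  have -> : [set z | phi k z < ratr (q k)] = phi k @^-1` `]-oo, ratr (q k)[.
    by apply/seteqP; split=> z /=; rewrite in_itv.
  by rewrite -[X in measurable X]setTI; apply: mphi => //; exact: measurable_itv.
pose d := c x - \sum_(k < N) phi k (x k).
have d0 : 0 < d by rewrite subr_gt0.
(* Of the slack [d] at [x], lower semicontinuity of [c] costs [d / 2] and the bounds on [phi] cost
   [d / 4] in all; at least [d / 4] remains. *)
have [V nV Vc] := @c_lsc x (c x - d / 2) ltac:(rewrite lte_fin; lra).
have [g [Ug gV]] := Ubox _ (@open_interior _ V) x nV.
have e0 : 0 < d / 4 / N%:R by rewrite !divr_gt0// ltr0n.
have /choice[q hq] : forall k, exists q : rat,
    phi k (x k) < ratr q < phi k (x k) + d / 4 / N%:R.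
  move=> k; have [|q] := @rat_in_itvoo R (phi k (x k)) (phi k (x k) + d / 4 / N%:R).
    by rewrite ltrDl.
  by rewrite in_itv/=; exists q.
exists (pickle (g, finfun q)); last first.
  move=> k; rewrite /F pickleK; split=> //=; rewrite ffunE.
  by have /andP[] := hq k.
exists (d / 4); first by rewrite divr_gt0.
move=> y Fy; have Vy : V y.
  apply: interior_subset; apply: gV => k.
  by have := Fy k; rewrite /F pickleK => -[].
have := Vc _ Vy; rewrite lte_fin => cy.
have : \sum_(k < N) phi k (y k) <= \sum_(k < N) (phi k (x k) + d / 4 / N%:R).
  apply: ler_sum => k _; have := Fy k; rewrite /F pickleK => -[_ /=].
  rewrite ffunE => /ltW/le_trans; apply; apply: ltW.
  by have /andP[] := hq k.
rewrite big_split/= sumr_const card_ord -(mulr_natr (d / 4 / N%:R)).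
rewrite divfK; last by rewrite pnatr_eq0 -lt0n.
rewrite /d in cy *; lra.
Qed.

(** The content vanishes on each box of the cover with slack bounded below, [P] agrees with it
    there, and a countable union of null sets is null. *)
Lemma dual_plan : exists P : probability (Borel (PiX X)) R,
  is_plan mu P /\ {ae P, forall x, c x = \sum_(k < N) phi k (x k)}.
Proof.
have [m [mE mnull]] := dual_content N_gt0 hphi.
have [P [Pplan PE]] := plan_of_content mE.
exists P; split=> //.
have [F [mF cover]] := slack_gt0_cover.
pose B n : set (PiX X) := [set x | forall k, F n k (x k)].
pose G n := if `[< exists2 r : R, 0 < r & forall x : PiX X,
     (forall k, F n k (x k)) -> r <= c x - \sum_(k < N) phi k (x k) >] then B n else set0.
have : P.-negligible (\bigcup_n G n).
  apply: negligible_bigcup => n; rewrite /G; case: asboolP => [[r r0 h]|_].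
    exists (B n); split=> //.
      by apply: measurable_big_preimage => // k; exact: PiX_proj_measurable.
    by apply: etrans (PE (F n) (mF n)) _; exact: mnull r0 h.
  exact: negligible_set0.
apply: negligibleS => x /= cx.
have [|n /= hn Fx] := cover x.
  rewrite /= lt_neqAle hphi.1.2 andbT; apply/eqP => e; exact: cx.
by exists n => //; rewrite /G asboolT.
Qed.
End Plan.

(* The library integral is a lower integral, hence monotone also on
   non-measurable functions. *)
Lemma le_integral_nonmeasurable d (T : measurableType d) (R : realType)
    (mu : {measure set T -> \bar R}) (f g : T -> \bar R) :
  (forall x, f x <= g x)%E -> (\int[mu]_x f x <= \int[mu]_x g x)%E.
Proof.
move=> fg.
have mono (u v : T -> \bar R) : (forall x, 0 <= u x)%E -> (forall x, u x <= v x)%E ->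
    (\int[mu]_x u x <= \int[mu]_x v x)%E.
  move=> u0 uv; have v0 x : (0 <= v x)%E by exact: le_trans (u0 x) (uv x).
  rewrite !ge0_integralTE//; apply: le_ereal_sup => _ [h hu <-].
  by exists h => // x; exact: le_trans (hu x) (uv x).
rewrite [leLHS]integralE [leRHS]integralE; apply: leeB; apply: mono => x //.
  by rewrite !funeposE ge_max le_max fg/= le_max lexx orbT.
by rewrite !funenegE ge_max le_max leeN2 fg/= le_max lexx orbT.
Qed.

(** * Change of variables for marginals *)

Section Marginal.
Context d d' (T : measurableType d) (U : measurableType d') {R : realType}.
Variables (P : {measure set T -> \bar R}) (Q : {measure set U -> \bar R}) (p : T -> U).
Hypotheses (mp : measurable_fun setT p)
  (PQ : forall A, measurable A -> P (p @^-1` A) = Q A).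

Lemma marginal_integral (f : U -> \bar R) : Q.-integrable setT f ->
  P.-integrable setT (f \o p) /\ (\int[P]_x (f \o p) x = \int[Q]_y f y)%E.
Proof.
pose Q' := measure_function_pushforward__canonical__measure_function_Measure P mp.
have QQ' A : measurable A -> Q A = Q' A by move=> mA; rewrite -PQ.
move=> fQ; have mf := measurable_int Q fQ.
have fp : P.-integrable setT (f \o p).
  apply/integrableP; split; first exact: measurableT_comp.
  have /integrableP[_] := fQ.
  rewrite (@eq_measure_integral _ _ _ _ Q'); last by move=> A mA _; exact: QQ'.
  rewrite ge0_integral_pushforward//; last by exact: measurableT_comp.
split=> //.
rewrite [RHS](@eq_measure_integral _ _ _ _ Q'); last by move=> A mA _; exact: QQ'.
apply/esym; exact: (integral_pushforward mp mf fp measurableT).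
Qed.
End Marginal.

(** * Optimal plans and the contact set *)

Section Optimal.
Context {R : realType} {N : nat} (X : 'I_N -> completePseudoMetricType R).
Hypotheses (N_gt0 : (0 < N)%N) (hX : forall k, polish (X k)).
Variable mu : forall k, probability (Borel (X k)) R.
Variables (c : PiX X -> R) (phi : forall k, X k -> R).
Arguments phi : clear implicits.
Hypothesis c_lsc : lower_semicontinuous (fun x : PiX X => (c x)%:E).
Hypothesis hphi : dual_solution mu c phi.

Lemma cost_measurable : measurable_fun setT (c : Borel (PiX X) -> R).
Proof.
apply: (@measurability _ _ (Borel (PiX X)) R setT c _ (RGenOInfty.measurableE R)).
move=> _ [_ [r ->] <-]; rewrite setTI; apply: sub_sigma_algebra.
rewrite openE => x /=; rewrite in_itv/= andbT => rx.
have [V nV Vc] := @c_lsc x r ltac:(by rewrite lte_fin).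
apply: filterS nV => y /Vc; rewrite lte_fin => ry.
by rewrite /= in_itv/= andbT.
Qed.

Lemma plan_sum_integral (lam : probability (Borel (PiX X)) R) : is_plan mu lam ->
  lam.-integrable setT (fun x => (\sum_(k < N) phi k (x k))%:E) /\
  (\int[lam]_x (\sum_(k < N) phi k (x k))%:E = dual_value mu phi)%E.
Proof.
move=> hlam.
have h k := marginal_integral (@PiX_proj_measurable _ _ X k) (hlam k) (hphi.1.1 k).
have e : (fun x : Borel (PiX X) => (\sum_(k < N) phi k (x k))%:E) =
    (fun x => (\sum_(k < N) (phi k (x k))%:E)%E).
  by apply/funext => x; rewrite sumEFin.
rewrite e; split.
  by apply: (@integrable_sum _ _ _ lam setT measurableT _ (index_enum 'I_N) xpredT
    (fun k (x : Borel (PiX X)) => (phi k (x k))%:E)) => k _; exact: (h k).1.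
rewrite (@integral_sum _ _ _ lam setT measurableT _
    (fun k (x : Borel (PiX X)) => (phi k (x k))%:E)).
  by apply: eq_bigr => k _; exact: (h k).2.
by move=> k; exact: (h k).1.
Qed.

(** The plan of [dual_plan] costs exactly the dual value, which is also the integral of the sum of
    the [phi k] under [lam]. Optimality of [lam] leaves nothing for the nonnegative slack. *)
Lemma optimal_plan_slack0 (lam : probability (Borel (PiX X)) R) :
  optimal_plan mu c lam -> {ae lam, forall x, c x = \sum_(k < N) phi k (x k)}.
Proof.
move=> [hlam lam_opt]; have [P [hP Pae]] := dual_plan N_gt0 hX c_lsc hphi.
pose g (x : Borel (PiX X)) := \sum_(k < N) phi k (x k).
have [ig Ig] := plan_sum_integral hlam.
have [igP IgP] := plan_sum_integral hP.
have mc := cost_measurable.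
have mg : measurable_fun setT g by apply/measurable_EFinP; exact: measurable_int igP.
have costP : cost_of c P = dual_value mu phi.
  rewrite -IgP; apply: ae_eq_integral => //.
  - exact/measurable_EFinP.
  - exact/measurable_EFinP.
  - have [A [mA A0 hA]] := Pae; exists A; split=> // x /= nx.
    by apply: hA => /= e; apply: nx => _; rewrite e.
(* Truncating the slack at 1 makes it integrable and keeps its zeros. *)
pose h (x : Borel (PiX X)) := Num.min (c x - g x) 1.
have h0 x : 0 <= h x by rewrite le_min subr_ge0 hphi.1.2/=.
have mh : measurable_fun setT h.
  by apply: measurable_minr => //; exact: measurable_funB.
have ih : lam.-integrable setT (EFin \o h).
  apply: (@le_integrable _ _ _ lam setT measurableT _ (EFin \o cst 1)).
  - exact/measurable_EFinP.
  - move=> x _ /=; rewrite lee_fin ger0_norm// normr1.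
    by rewrite ge_min lexx orbT.
  - exact: finite_measure_integrable_cst.
have : (\int[lam]_x ((g x)%:E + (h x)%:E) <= dual_value mu phi)%E.
  rewrite -costP; apply: le_trans (lam_opt _ hP).
  apply: le_integral_nonmeasurable => x; rewrite -EFinD lee_fin.
  have : h x <= c x - g x by rewrite ge_min lexx.
  lra.
rewrite integralD//= Ig -[leRHS]adde0 leeD2lE; last first.
  by rewrite -Ig; exact: integrable_fin_num.
move=> Ih.
have : (\int[lam]_x `|(h x)%:E| = 0)%E.
  apply/eqP; rewrite eq_le integral_ge0 ?andbT//; apply: le_trans Ih.
  by apply: le_integral_nonmeasurable => x; rewrite gee0_abs ?lee_fin.
have mEh : measurable_fun setT (EFin \o h) by exact/measurable_EFinP.
move/(ae_eq_integral_abs lam measurableT mEh).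
move=> [A [mA A0 hA]]; exists A; split=> // x /= cx; apply: hA => /= hx.
apply: cx; have /eqP := hx I; rewrite eqe => /eqP.
rewrite /h /Num.min; case: ifP => _ e.
  by rewrite -[c x](subrK (g x)) e add0r.
by move/eqP: e; rewrite oner_eq0.
Qed.
End Optimal.

(** * Projections of optimal plans *)

Lemma continuous_fst (T U : topologicalType) : continuous (@fst T U).
Proof. by move=> [x y] A nA; exists (A, setT) => /= [|[a b] []//]; split=> //; exact: filterT. Qed.

Lemma continuous_snd (T U : topologicalType) : continuous (@snd T U).
Proof. by move=> [x y] A nA; exists (setT, A) => /= [|[a b] []//]; split=> //; exact: filterT. Qed.

Lemma prod_hausdorff (T U : topologicalType) :
  hausdorff_space T -> hausdorff_space U -> hausdorff_space (T * U)%type.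
Proof.
move=> hT hU [x y] [x' y'] h; congr pair.
  apply: hT => A B nA nB; have [||[a b] [/= Aa Ba]] := h (fst @^-1` A) (fst @^-1` B).
  - exact: (@continuous_fst _ _ (x, y)).
  - exact: (@continuous_fst _ _ (x', y')).
  by exists a.
apply: hU => A B nA nB; have [||[a b] [/= Aa Ba]] := h (snd @^-1` A) (snd @^-1` B).
- exact: (@continuous_snd _ _ (x, y)).
- exact: (@continuous_snd _ _ (x', y')).
by exists b.
Qed.

(** Dynkin's argument: rectangles are stable under intersection and generate the product
    sigma-algebra, and both sides respect complements and countable disjoint unions. *)
Lemma kernel_disintegration_integral d d' (T : measurableType d) (U : measurableType d')
    (R : realType) (P : probability (T * U)%type R) (Q : probability T R)
    (k : R.-pker T ~> U) :
  (forall A B, measurable A -> measurable B ->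
    P (A `*` B) = \int[Q]_(x in A) k x B)%E ->
  forall A, measurable A -> P A = (\int[Q]_x k x (xsection A x))%E.
Proof.
move=> h; rewrite measurable_prod_measurableType.
have mk A : measurable A -> measurable_fun setT (fun x => k x (xsection A x)).
  by move=> mA; apply: (measurable_fun_xsection_finite_kernel k); rewrite inE.
have k1 x : (k x setT = 1)%E by exact: prob_kernel.
have k_fin x A : measurable A -> k x A \is a fin_num.
  move=> mA; rewrite ge0_fin_numE//; apply: (@le_lt_trans _ _ (k x setT)).
    by apply: le_measure; rewrite ?inE.
  by rewrite k1 ltry.
apply: dynkin_induction.
- exact: measurable_prod_measurableType.
- move=> _ _ [A1 mA1 [A2 mA2 <-]] [B1 mB1 [B2 mB2 <-]].
  exists (A1 `&` B1); first exact: measurableI.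
  exists (A2 `&` B2); first exact: measurableI.
  by rewrite setXI.
- rewrite -setXTT h//; apply: eq_integral => x _.
  by rewrite in_xsectionX// inE.
- move=> _ [A mA [B mB <-]]; rewrite h// integral_mkcond.
  apply: eq_integral => x _; rewrite patchE; case: ifPn => xA.
    by rewrite in_xsectionX.
  by rewrite notin_xsectionX// measure0.
- move=> S mS PS; have mSx x := measurable_xsection x mS.
  have iS : Q.-integrable setT (fun x => k x (xsection S x)).
    apply: (@le_integrable _ _ _ Q setT measurableT _ (EFin \o cst 1)).
    + exact: mk.
    + move=> x _ /=; rewrite gee0_abs// normr1 -(k1 x).
      by apply: le_measure; rewrite ?inE.
    + exact: finite_measure_integrable_cst.
  transitivity (\int[Q]_x (1 - k x (xsection S x)))%E.
    rewrite integralB//; last exact: finite_measure_integrable_cst.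
    rewrite integral_cst// mul1e -PS; apply: etrans (probability_setC P mS) _.
    by congr (_ - _)%E; apply/esym; exact: probability_setT.
  apply: eq_integral => x _.
  have -> : xsection (~` S) x = setT `\` xsection S x.
    by rewrite setTD; apply/seteqP; split=> y; rewrite /xsection /= !inE.
  have kT : (k x setT < +oo)%E by rewrite k1 ltry.
  apply/esym/(etrans (measureD measurableT (mSx x) kT)).
  by rewrite setTI; congr (_ - _)%E; exact: k1.
- move=> F mF tF PF.
  rewrite measure_semi_bigcup//; last exact: bigcupT_measurable.
  rewrite (eq_eseriesr (fun n _ => PF n)) -integral_nneseries//; last first.
    by move=> n; exact: mk.
  apply: eq_integral => x _; rewrite xsection_bigcup measure_semi_bigcup//.
  + by move=> n; exact: measurable_xsection.
  + exact: trivIset_xsection.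
  + by apply: bigcupT_measurable => n; exact: measurable_xsection.
Qed.

Section Projection.
Context {R : realType} {N : nat} (X : 'I_N -> completePseudoMetricType R).
Hypotheses (N_gt0 : (0 < N)%N) (hX : forall k, polish (X k)).
Variable mu : forall k, probability (Borel (X k)) R.
Variable lam : probability (Borel (PiX X)) R.
Hypothesis hlam : is_plan mu lam.

(** Cylinders are regular by the marginals and generate the Borel sets; the regular sets of a
    measure form a sigma-algebra. *)
Lemma plan_compact_regular (A : set (Borel (PiX X))) : measurable A ->
  @compact_regular _ (PiX_ptop X) lam A.
Proof.
have cyl k (B : set (Borel (X k))) : measurable B ->
    @compact_regular _ (PiX_ptop X) lam ((fun x : PiX X => x k) @^-1` B).
  by move=> mB; apply: (PiX_cylinder_compact_regular hX hlam).
have hP := @PiX_hausdorff _ _ _ hX.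
pose G : set (set (PiX_ptop X)) := [set A | exists k (B : set (Borel (X k))),
  measurable B /\ A = (fun x : PiX X => x k) @^-1` B].
have GA : G `<=` @compact_regular _ (PiX_ptop X) lam.
  by move=> _ [k [B [mB ->]]]; exact: cyl.
have r0 : @compact_regular _ (PiX_ptop X) lam set0.
  exact: (@compact_regular0 R (PiX_ptop X) hP lam _ (cyl (Ordinal N_gt0) _ measurableT)).
move=> mA; apply: (@compact_regular_sigma_algebra R (PiX_ptop X) hP lam G r0 GA).
have /(_ measurableT _ mA) : measurable_fun setT
    (id : g_sigma_algebraType G -> Borel (PiX X)).
  apply: PiX_measurable_fun => // k _ B mB.
  by rewrite setTI; apply: sub_sigma_algebra; exists k, B.
by rewrite setTI preimage_id.
Qed.

(* A measurable set of full measure contains a sigma-compact one, whose image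
   is Borel, whereas the image of the set itself may be non-measurable. *)
Lemma image_full_measure (Y : ptopologicalType) (f : PiX X -> Y)
    (S : set (Borel (PiX X))) :
  hausdorff_space Y -> continuous f -> measurable S -> lam (~` S) = 0%E ->
  exists B : set (Borel Y), [/\ measurable B, lam (f @^-1` (~` B)) = 0%E &
    B `<=` f @` S].
Proof.
move=> hY cf mS S0.
have e0 n : 0 < (n.+1%:R^-1 : R) by rewrite invr_gt0.
have hP := @PiX_hausdorff _ _ _ hX.
have mK (K : set (PiX X)) : compact K -> measurable (K : set (Borel (PiX X))).
  exact: (@compact_Borel (PiX_ptop X) hP).
have /choice[K hK] : forall n, exists K : set (PiX X),
    [/\ compact K, K `<=` S & (lam (~` K) <= (n.+1%:R^-1)%:E)%E].
  move=> n; have [K [K' [cK cK' KS KS' lamK]]] := plan_compact_regular mS (e0 n).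
  (* [K'] lies in the null complement of [S], so [K] alone carries almost all mass. *)
  exists K; split=> //; rewrite -[leRHS]adde0 -S0.
  apply: le_trans (leeD lamK (le_refl _)).
  have mC : measurable (~` (K `|` K') : set (Borel (PiX X))).
    by apply: measurableC; apply: measurableU; exact: mK.
  apply: le_trans (measureU2 _ _ _); last 2 first.
  - exact: mC.
  - exact: measurableC.
  apply: le_measure; rewrite ?inE.
  - by apply: measurableC; exact: mK.
  - by apply: measurableU; [exact: mC|exact: measurableC].
  - move=> x nKx; have [K'x|nK'x] := pselect (K' x); first by right; exact: KS'.
    by left=> -[].
exists (\bigcup_n (f @` K n)); split.
- apply: bigcupT_measurable => n; apply: (compact_Borel hY).
  apply: continuous_compact; last by have [] := hK n.
  exact: continuous_subspaceT.
- apply/eqP; rewrite eq_le measure_ge0 andbT; apply/lee_addgt0Pr => e ep.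
  rewrite add0e; have [n _ /(_ _ (leqnn n)) ne] := near_infty_natSinv_lt (PosNum ep).
  have [cK KS lamK] := hK n; apply: (@le_trans _ _ (n.+1%:R^-1)%:E); last first.
    by rewrite lee_fin ltW.
  apply: le_trans lamK; apply: le_measure; rewrite ?inE.
  + rewrite -[X in measurable X]setTI.
    apply: (@continuous_Borel_measurable (PiX_ptop X) Y f cf) => //.
    apply: measurableC; apply: bigcupT_measurable => m; apply: (compact_Borel hY).
    apply: continuous_compact; last by have [] := hK m.
    exact: continuous_subspaceT.
  + by apply: measurableC; exact: mK.
  + by move=> x /= nx Kx; apply: nx; exists n => //; exists x.
- by move=> _ [n _ [x Kx <-]]; exists x => //; have [_ KS _] := hK n; exact: KS.
Qed.
End Projection.

Definition prod_ptop {R : realType} (T U : completePseudoMetricType R) :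
  ptopologicalType :=
  HB.pack (T * U)%type (Pointed.class ((T * U)%type : pointedType)).

(** * Measurability of graphs *)

Section Graph.
Context {R : realType} (T U : completePseudoMetricType R).

Lemma Borel_fst_measurable :
  measurable_fun setT (fst : Borel (T * U)%type -> Borel T).
Proof.
exact: (@continuous_Borel_measurable (prod_ptop T U) T fst (@continuous_fst T U)).
Qed.

Lemma Borel_snd_measurable :
  measurable_fun setT (snd : Borel (T * U)%type -> Borel U).
Proof.
exact: (@continuous_Borel_measurable (prod_ptop T U) U snd (@continuous_snd T U)).
Qed.

(** [t x] and [y] differ exactly when some basic open set contains [t x] but not [y]. *)
Lemma graph_complement_measurable (t : Borel T -> Borel U) : polish U ->
  measurable_fun setT t ->
  measurable ([set z | t z.1 != z.2] : set (Borel (T * U)%type)).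
Proof.
move=> hU mt; have [V [oV Vb]] := polish_countable_base hU.
have -> : [set z : T * U | t z.1 != z.2] =
    \bigcup_n ((t \o fst) @^-1` V n `&` snd @^-1` (~` V n)).
  apply/seteqP; split=> [[x y] /= /eqP xy|[x y] [n _ [/= Vt nV]]].
    have [|n Vn nV] := Vb (t x) (~` [set y]).
      apply: open_nbhs_nbhs; split=> //; apply: closed_openC.
      by apply: accessible_closed_set1; exact: hausdorff_accessible hU.1.
    exists n => //; split => //= Vy; exact: (nV _ Vy).
  by apply/eqP => e; apply: nV; rewrite -e.
have m1 := Borel_fst_measurable.
have m2 := Borel_snd_measurable.
have mV n : measurable (V n : set (Borel U)) by apply: sub_sigma_algebra; exact: oV.
apply: bigcupT_measurable => n; apply: measurableI.
  rewrite -[X in measurable X]setTI.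
  have mt1 : measurable_fun setT (t \o (fst : Borel (T * U)%type -> Borel T)).
    exact: measurableT_comp.
  exact: mt1.
rewrite -[X in measurable X]setTI; apply: m2 => //; exact: measurableC.
Qed.
End Graph.

(** * The two-marginal problems *)

Section TwoMarginal.
Context {R : realType} {N : nat} (X : 'I_N -> completePseudoMetricType R).
Hypotheses (N_gt0 : (0 < N)%N) (hX : forall k, polish (X k)).
Variable mu : forall k, probability (Borel (X k)) R.
Variables (c : PiX X -> R) (phi : forall k, X k -> R).
Arguments phi : clear implicits.
Hypothesis c_lsc : lower_semicontinuous (fun x : PiX X => (c x)%:E).
Hypothesis hphi : dual_solution mu c phi.
Variables (i j : 'I_N).
Hypothesis ji : j != i.

Let pr (x : PiX X) : X i * X j := (x i, x j).

Let pr_continuous : continuous (pr : PiX X -> prod_ptop (X i) (X j)).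
Proof.
move=> x; apply: (@cvg_pair _ _ _ (nbhs x) (nbhs (x i)) (nbhs (x j))).
  exact: (@PiX_proj_continuous R N X i x).
exact: (@PiX_proj_continuous R N X j x).
Qed.

Lemma pair_proj_measurable :
  measurable_fun setT (pr : Borel (PiX X) -> Borel (X i * X j)%type).
Proof.
exact: (@continuous_Borel_measurable (PiX_ptop X) (prod_ptop (X i) (X j)) pr pr_continuous).
Qed.

Let sum_split (x : PiX X) : \sum_(k < N) phi k (x k) =
  phi i (x i) + phi j (x j) + \sum_(k < N | (k != i) && (k != j)) phi k (x k).
Proof. by rewrite (bigD1 i)//= (bigD1 j)//= addrA. Qed.

Lemma c1j_ge (y : X i) (z : X j) : ((phi i y + phi j z)%:E <= c1j i c phi j y z)%E.
Proof.
apply: le_ereal_inf_tmp => _ [x [<- <-] <-]; rewrite lee_fin.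
have := hphi.1.2 x; rewrite sum_split; lra.
Qed.

Lemma c1j_le (x : PiX X) : c x = \sum_(k < N) phi k (x k) ->
  (c1j i c phi j (x i) (x j) <= (phi i (x i) + phi j (x j))%:E)%E.
Proof.
move=> cx; apply: ereal_inf_lbound; exists x => //.
by congr EFin; rewrite cx sum_split addrK.
Qed.

Lemma plan2_integral (tau : probability (Borel (X i * X j)%type) R) :
  is_plan2 (mu i) (mu j) tau ->
  tau.-integrable setT (fun z => (phi i z.1 + phi j z.2)%:E) /\
  (\int[tau]_z (phi i z.1 + phi j z.2)%:E =
   \int[mu i]_y (phi i y)%:E + \int[mu j]_z (phi j z)%:E)%E.
Proof.
move=> [tau1 tau2].
have [i1 I1] : tau.-integrable setT (fun z => (phi i z.1)%:E) /\
    (\int[tau]_z (phi i z.1)%:E = \int[mu i]_y (phi i y)%:E)%E.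
  have PQ (A : set (Borel (X i))) : measurable A -> tau (fst @^-1` A) = mu i A.
    by move=> mA; rewrite -tau1//; congr (tau _); apply/seteqP; split=> z //= [].
  exact: (marginal_integral (@Borel_fst_measurable R (X i) (X j)) PQ (hphi.1.1 i)).
have [i2 I2] : tau.-integrable setT (fun z => (phi j z.2)%:E) /\
    (\int[tau]_z (phi j z.2)%:E = \int[mu j]_y (phi j y)%:E)%E.
  have PQ (A : set (Borel (X j))) : measurable A -> tau (snd @^-1` A) = mu j A.
    by move=> mA; rewrite -tau2//; congr (tau _); apply/seteqP; split=> z //= [].
  exact: (marginal_integral (@Borel_snd_measurable R (X i) (X j)) PQ (hphi.1.1 j)).
split; last by rewrite -I1 -I2 -integralD.
by apply: eq_integrable (integrableD measurableT i1 i2).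
Qed.

(** [c1j] dominates [phi i + phi j], whose integral depends on the marginals only; this bounds all
    costs from below. For the projection of [lam] equality holds almost everywhere. *)
Lemma projection_optimal (lam : probability (Borel (PiX X)) R) :
  optimal_plan mu c lam ->
  exists tau : probability (Borel (X i * X j)%type) R,
    (forall A, tau A = lam (pr @^-1` A)) /\
    optimal_plan2 (mu i) (mu j) (c1j i c phi j) tau.
Proof.
move=> lam_opt; have hlam := lam_opt.1.
have [tau tauE] := pushforward_probability pair_proj_measurable (probability_setT lam).
exists tau; split=> //.
have htau : is_plan2 (mu i) (mu j) tau.
  split=> A mA; rewrite tauE -hlam//; congr (lam _); apply/seteqP.
    by split=> x //= [].
  by split=> x //= [].
split=> // tau' htau'.
have [ig Ig] := plan2_integral htau.
have [ig' Ig'] := plan2_integral htau'.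
apply: (@le_trans _ _ (\int[tau']_z (phi i z.1 + phi j z.2)%:E)%E); last first.
  by apply: le_integral_nonmeasurable => z; exact: c1j_ge.
rewrite Ig' -Ig.
have mg := measurable_int tau ig.
have [A [mA A0 hA]] := optimal_plan_slack0 N_gt0 hX c_lsc hphi lam_opt.
(* [B] is a Borel set of full measure inside the projection of the contact set. *)
have [|B [mB B0 hB]] := @image_full_measure _ _ _ N_gt0 hX _ _ hlam
  (prod_ptop (X i) (X j)) pr (~` A) (prod_hausdorff (hX i).1 (hX j).1) pr_continuous
  (measurableC mA).
  by rewrite setCK.
(* Measurability of [c1j] is not established; [u] is a measurable upper bound equal to
   [phi i + phi j] on [B]. *)
pose u (z : Borel (X i * X j)%type) : \bar R :=
  if z \in B then (phi i z.1 + phi j z.2)%:E else +oo%E.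
have mu_ : measurable_fun setT u.
  apply: measurable_fun_ifT => //.
  apply: (measurable_fun_bool true); rewrite setTI.
  rewrite (_ : _ @^-1` _ = B)//.
  by apply/seteqP; split=> z /= => [/set_mem|/mem_set].
apply: (@le_trans _ _ (\int[tau]_z u z)%E).
  apply: le_integral_nonmeasurable => z; rewrite /u.
  have [/set_mem /hB[x nAx <-]|_] := boolP (z \in B); last exact: leey.
  by apply: c1j_le; apply: contrapT => cx; apply: nAx; apply: hA.
rewrite (@ae_eq_integral _ _ _ tau setT (fun z => (phi i z.1 + phi j z.2)%:E) u)//.
exists (~` B); split.
- exact: measurableC.
- exact: etrans (tauE _) B0.
- move=> z /= nz Bz; apply: nz => _; rewrite /u mem_set//.
Qed.
End TwoMarginal.

(** * Points on the graphs of the transport maps *)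

Section Updates.
Context {R : realType} {N : nat} (X : 'I_N -> completePseudoMetricType R).

Lemma upd_same (x : PiX X) j (y : X j) : upd x j y j = y.
Proof.
by rewrite /upd; case: eqP => // e; rewrite (eq_irrelevance e erefl).
Qed.

Lemma upd_other (x : PiX X) j (y : X j) k : k != j -> upd x j y k = x k.
Proof. by move=> kj; rewrite /upd; case: eqP => // e; case/eqP: kj. Qed.

Variables (i j0 : 'I_N) (t : forall j, Borel (X i) -> Borel (X j)).
Hypotheses (hX : forall k, polish (X k))
  (mt : forall j, j != i -> j != j0 -> measurable_fun setT (@t j)).

(** The values of [t] at [i] and [j0] are placeholders, overwritten by [y] and [z]; this is the
    point the theorem tests for membership in [S]. *)
Definition graph_point (y : X i) (z : X j0) : PiX X :=
  upd (upd (fun k => t k y) i y) j0 z.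

Lemma graph_point_measurable d (Z : measurableType d) (f : Z -> Borel (X i))
    (g : Z -> Borel (X j0)) :
  measurable_fun setT f -> measurable_fun setT g ->
  measurable_fun setT ((fun z => graph_point (f z) (g z)) : Z -> Borel (PiX X)).
Proof.
move=> mf mg; apply: PiX_measurable_fun => // k; rewrite /graph_point.
have [->|kj0] := eqVneq k j0.
  by under eq_fun do rewrite upd_same.
under eq_fun do rewrite upd_other//.
have [->|ki] := eqVneq k i.
  by under eq_fun do rewrite upd_same.
under eq_fun do rewrite upd_other//.
exact: (measurableT_comp (mt ki kj0) mf).
Qed.

Lemma graph_pointE (x : PiX X) :
  (forall j, j != i -> j != j0 -> x j = t j (x i)) ->
  graph_point (x i) (x j0) = x.
Proof.
move=> h; apply: functional_extensionality_dep => k; rewrite /graph_point.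
have [->|kj0] := eqVneq k j0; first by rewrite upd_same.
rewrite upd_other//.
have [->|ki] := eqVneq k i; first by rewrite upd_same.
by rewrite upd_other//; apply/esym; exact: h.
Qed.
End Updates.

(** * Structure and uniqueness of optimal plans *)

Theorem mainTheorem6 (R : realType) (N : nat) (hN : (3 <= N)%N)
  (X : 'I_N -> completePseudoMetricType R)
  (hX : forall k, polish (X k))
  (mu : forall k, probability (Borel (X k)) R)
  (c : PiX X -> R)
  (hc_lsc : lower_semicontinuous (fun x : PiX X => (c x)%:E))
  (a : forall k, X k -> R)
  (ha : forall k, (mu k).-integrable [set: Borel (X k)] (fun x => (a k x)%:E))
  (hca : forall x : PiX X, \sum_(k < N) a k (x k) <= c x)
  (hattained : exists lam, optimal_plan mu c lam)
  (phi : forall k, X k -> R)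
  (hphi : dual_solution mu c phi)
  (j0 : 'I_N) (hj0 : j0 != idx1 hN)
  (T : forall j, Borel (X (idx1 hN)) -> Borel (X j))
  (hT : forall j, j != idx1 hN -> j != j0 ->
     measurable_fun [set: Borel (X (idx1 hN))] (T j) /\
     (exists tau, optimal_plan2 (mu (idx1 hN)) (mu j) (c1j (idx1 hN) c phi j) tau) /\
     (forall tau, is_plan2 (mu (idx1 hN)) (mu j) tau ->
        (optimal_plan2 (mu (idx1 hN)) (mu j) (c1j (idx1 hN) c phi j) tau <->
         forall S : set (Borel (X (idx1 hN) * X j)%type), measurable S ->
           tau S = mu (idx1 hN) ((fun x => (x, T j x)) @^-1` S)))) :
  (forall (lam : probability (Borel (PiX X)) R)
          (kappa : R.-pker (Borel (X (idx1 hN))) ~> (Borel (X j0))),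
     optimal_plan mu c lam ->
     (forall (E : set (Borel (X (idx1 hN)))) (F : set (Borel (X j0))),
        measurable E -> measurable F ->
        lam ((fun x : PiX X => (x (idx1 hN), x j0)) @^-1` (E `*` F)) =
        (\int[mu (idx1 hN)]_(x1 in E) kappa x1 F)%E) ->
     forall S : set (Borel (PiX X)), measurable S ->
       lam S =
       (\int[mu (idx1 hN)]_x1
          kappa x1 [set y : X j0 |
            S (upd (upd (fun k => T k x1) (idx1 hN) x1) j0 y)])%E)
  /\
  ((forall tau1 tau2,
      optimal_plan2 (mu (idx1 hN)) (mu j0) (c1j (idx1 hN) c phi j0) tau1 ->
      optimal_plan2 (mu (idx1 hN)) (mu j0) (c1j (idx1 hN) c phi j0) tau2 ->
      forall S : set (Borel (X (idx1 hN) * X j0)%type), measurable S ->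
        tau1 S = tau2 S) ->
   forall lam1 lam2 : probability (Borel (PiX X)) R,
     optimal_plan mu c lam1 -> optimal_plan mu c lam2 ->
     forall S : set (Borel (PiX X)), measurable S -> lam1 S = lam2 S).
Proof.
set i := idx1 hN.
have N_gt0 : (0 < N)%N by exact: (leq_trans _ hN).
pose pr (x : PiX X) : X i * X j0 := (x i, x j0).
pose Phi (z : X i * X j0) : PiX X := graph_point T z.1 z.2.
have mT j : j != i -> j != j0 -> measurable_fun setT (T j).
  by move=> ji jj0; exact: (hT j ji jj0).1.
(* The source is arbitrary since [Phi] is used on the Borel and on the product sigma-algebra of
   pairs, and composed with [pr]. *)
have mPhi d (Z : measurableType d) (f : Z -> Borel (X i)) (g : Z -> Borel (X j0)) :
    measurable_fun setT f -> measurable_fun setT g ->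
    measurable_fun setT ((fun z => Phi (f z, g z)) : Z -> Borel (PiX X)).
  exact: graph_point_measurable.
have mPhiB : measurable_fun setT (Phi : Borel (X i * X j0)%type -> Borel (PiX X)).
  exact: (mPhi _ _ _ _ (@Borel_fst_measurable R (X i) (X j0))
    (@Borel_snd_measurable R (X i) (X j0))).
have mi := @PiX_proj_measurable R N X i.
have mj0 := @PiX_proj_measurable R N X j0.
(* By hypothesis the projection of [lam], being optimal, is the image of [mu i] on the graph of
   [T j], so it has no mass off the graph. *)
have graph (lam : probability (Borel (PiX X)) R) :
    optimal_plan mu c lam -> forall j, j != i -> j != j0 ->
    lam [set x : PiX X | T j (x i) != x j] = 0%E.
  move=> lam_opt j ji jj0.
  have [tau [tauE tau_opt]] :=
    projection_optimal N_gt0 hX hc_lsc hphi ji lam_opt.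
  have [mTj [_ /(_ tau tau_opt.1)[/(_ tau_opt) tauT _]]] := hT j ji jj0.
  have := tauT _ (graph_complement_measurable (hX j) mTj).
  rewrite tauE => ->; rewrite (_ : _ @^-1` _ = set0) ?measure0//.
  by apply/seteqP; split=> x //=; rewrite eqxx.
(* Off a null set [x = Phi (pr x)], so [lam] is determined by its projection to [X i * X j0]. Both
   claims follow from this. *)
have factor (lam : probability (Borel (PiX X)) R) :
    optimal_plan mu c lam -> forall S : set (Borel (PiX X)),
    measurable S -> lam S = lam (pr @^-1` (Phi @^-1` S)).
  move=> lam_opt S mS.
  (* Coordinates [i] and [j0] carry no graph constraint and contribute the empty set. *)
  pose D j : set (Borel (PiX X)) :=
    if (j != i) && (j != j0) then [set x : PiX X | T j (x i) != x j] else set0.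
  have mD j : measurable (D j).
    rewrite /D; case: ifPn => [/andP[ji jj0]|_]; last exact: measurable0.
    have := @pair_proj_measurable R N X i j measurableT _
      (graph_complement_measurable (hX j) (mT j ji jj0)).
    by rewrite setTI.
  pose E := \big[setU/set0]_(j <- index_enum 'I_N) D j.
  have mE : measurable E by apply: bigsetU_measurable.
  have E0 : lam E = 0%E.
    apply/eqP; rewrite eq_le measure_ge0 andbT.
    apply: le_trans (content_subadditive_big _ _ mD) _.
    rewrite big1// => j _; rewrite /D; case: ifPn => [/andP[ji jj0]|_].
      exact: graph.
    exact: measure0.
  have mQ : measurable (pr @^-1` (Phi @^-1` S) : set (Borel (PiX X))).
    by have := mPhi _ _ _ _ mi mj0 measurableT _ mS; rewrite setTI.
  have eqE x : ~ E x -> Phi (pr x) = x.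
    move=> nE; apply: graph_pointE => j ji jj0; apply/esym/eqP.
    apply: contrapT => /negP h; apply: nE; rewrite /E -bigcup_seq.
    by exists j; rewrite /= ?mem_index_enum// /D ji jj0.
  have le_null (A B : set (Borel (PiX X))) : measurable A -> measurable B ->
      A `<=` B `|` E -> (lam A <= lam B)%E.
    move=> mA mB AB; rewrite -[leRHS]adde0 -E0.
    apply: le_trans (measureU2 _ mB mE).
    by apply: le_measure; rewrite ?inE//; exact: measurableU.
  apply/eqP; rewrite eq_le; apply/andP; split; apply: le_null => // x Sx.
    have [Ex|nE] := pselect (E x); [by right|left].
    by rewrite /= eqE.
  have [Ex|nE] := pselect (E x); [by right|left].
  by move: Sx; rewrite /= eqE.
split=> [lam kappa lam_opt hkappa S mS|uniq lam1 lam2 opt1 opt2 S mS].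
  (* The projection is taken on the product sigma-algebra, where rectangles and the kernel determine
     it. *)
  have [P PE] := pushforward_probability (measurable_fun_pair mi mj0)
    (probability_setT lam).
  rewrite (factor lam lam_opt S mS).
  have mPhiP : measurable_fun setT
      (Phi : (Borel (X i) * Borel (X j0))%type -> Borel (PiX X)).
    exact: (mPhi _ _ _ _ measurable_fst measurable_snd).
  have mS' : measurable (Phi @^-1` S : set (Borel (X i) * Borel (X j0))).
    by rewrite -[X in measurable X]setTI; exact: mPhiP.
  have := @kernel_disintegration_integral _ _ _ _ R P (mu i) kappa _ _ mS'.
  rewrite PE => ->.
    apply: eq_integral => x _; congr (kappa x _).
    by apply/seteqP; split=> y; rewrite /xsection/= inE.
  by move=> A B mA mB; exact: etrans (PE _) (hkappa A B mA mB).
(* Here the projections are on the Borel sets of [X i * X j0], where the uniqueness hypothesis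
   identifies them. *)
have [tau1 [tau1E tau1_opt]] := projection_optimal N_gt0 hX hc_lsc hphi hj0 opt1.
have [tau2 [tau2E tau2_opt]] := projection_optimal N_gt0 hX hc_lsc hphi hj0 opt2.
have mS' : measurable (Phi @^-1` S : set (Borel (X i * X j0)%type)).
  by rewrite -[X in measurable X]setTI; exact: mPhiB.
have := uniq _ _ tau1_opt tau2_opt _ mS'.
by rewrite tau1E tau2E -!factor.
Qed.
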